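(* Let $\mathbb{M}=(M_p)_{p\in\mathbb{N}_0}$ be a sequence of positive real numbers with $M_0=1$ which is logarithmically convex, whose sequence of quotients $m_p=M_{p+1}/M_p$ satisfies $\lim_{p\to\infty}m_p=\infty$, and which admits a nonzero proximate order. Let $0<\gamma<\omega(\mathbb{M})$. Suppose $f$ is a bounded holomorphic function in $S_\gamma$ that admits a continuous extension to the boundary $\partial S_\gamma$, and that is $\mathbb{M}$-flat in direction $d=\pi\gamma/2$. Then for every $0<\delta<\pi\gamma$ there exist constants $k_1(\delta),k_2(\delta)>0$ such that $$|f(z)|\le k_1(\delta)\,e^{-M(1/(k_2(\delta)|z|))}\qquad\text{for all } z \text{ with } \arg(z)\in[-\pi\gamma/2+\delta,\pi\gamma/2].$$
   Context: $\mathbb{N}_0=\{0,1,2,\dots\}$. $\mathcal{R}$ is the Riemann surface of the logarithm. $S_\gamma=\{z\in\mathcal{R}:|\arg(z)|<\pi\gamma/2\}$; its boundary $\partial S_\gamma$ is taken in $\mathcal{R}$, i.e. it consists of the two rays $\arg(z)=\pm\pi\gamma/2$, $|z|>0$, the origin being disregarded. The continuous extension of $f$ to the boundary is still denoted $f$. $\mathbb{M}$ is logarithmically convex if $M_p^2\le M_{p-1}M_{p+1}$ for all $p\ge1$. $\omega(\mathbb{M})=\liminf_{p\to\infty}\log(m_p)/\log(p)$. For $t>0$ put $M(t)=\sup_{p\in\mathbb{N}_0}\log(t^p/M_p)$ and, for $t$ large, $d_{\mathbb{M}}(t)=\log(M(t))/\log(t)$. A proximate order is a real function $\rho(r)$ on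 some $(c,\infty)$, $c\ge0$, such that: (A) $\rho$ is continuous and piecewise continuously differentiable (differentiable except possibly at a sequence of points tending to infinity, at each of which it is continuous and has distinct finite one-sided derivatives); (B) $\rho(r)\ge0$ for all $r>c$; (C) $\lim_{r\to\infty}\rho(r)=\rho<\infty$; (D) $\lim_{r\to\infty}r\rho'(r)\ln r=0$. It is nonzero if the limit $\rho$ in (C) is positive. $\mathbb{M}$ admits a nonzero proximate order if there are a nonzero proximate order $\rho(t)$ and real constants $A,B$ such that $A\le\log(t)\,(\rho(t)-d_{\mathbb{M}}(t))\le B$ for all $t$ large enough. $f$ is $\mathbb{M}$-flat in direction $\theta$ if it has null $\mathbb{M}$-asymptotic expansion in that direction, i.e. there exist $r_\theta,C_\theta,A_\theta>0$ such that $f$ is defined on the segment of points with argument $\theta$ and modulus in $(0,r_\theta]$, and $|f(z)|\le C_\theta A_\theta^pM_p|z|^p$ for all such $z$ and all $p\in\mathbb{N}_0$ (equivalently $|f(z)|\le C_\theta e^{-M(1/(A_\theta|z|))}$ for all such $z$). *)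

(* Defs.v *)
(* Classical reals of the standard library, with Coquelicot. *)
From Stdlib Require Import Reals.
From Coquelicot Require Import Coquelicot.
Open Scope R_scope.

(* The Riemann surface of the logarithm.  The point with modulus r > 0 and
   argument theta is encoded by the pair (ln r, theta), that is, by its
   logarithm, so that every pair is a point and the topology of the surface is
   the product topology. *)
Definition logsurf : Type := (R * R)%type.

Definition modulus (z : logsurf) : R := exp (fst z).
Definition arg (z : logsurf) : R := snd z.

Definition proj (z : logsurf) : C :=
  (modulus z * cos (arg z), modulus z * sin (arg z)).

(* [proj] is the local coordinate defining the complex structure; it is
   injective near each point, so the denominator does not vanish near z. *)
Definition holomorphic_at (f : logsurf -> C) (z : logsurf) : Prop :=
  exists l : C,
    filterlim (fun w : logsurf => ((f w - f z) / (proj w - proj z))%C)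
      (locally' (z : R * R)) (locally l).

Definition holomorphic_on (D : logsurf -> Prop) (f : logsurf -> C) : Prop :=
  forall z, D z -> holomorphic_at f z.

Definition bounded_on (D : logsurf -> Prop) (f : logsurf -> C) : Prop :=
  exists K : R, forall z, D z -> Cmod (f z) <= K.

Definition sector (g : R) (z : logsurf) : Prop := Rabs (arg z) < PI * g / 2.

Definition sector_boundary (g : R) (z : logsurf) : Prop :=
  arg z = PI * g / 2 \/ arg z = - (PI * g / 2).

Definition closed_sector (g : R) (z : logsurf) : Prop :=
  sector g z \/ sector_boundary g z.

Definition log_convex (M : nat -> R) : Prop :=
  forall p : nat, (1 <= p)%nat -> M p ^ 2 <= M (p - 1)%nat * M (p + 1)%nat.

Definition quotients (M : nat -> R) (p : nat) : R := M (S p) / M p.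

Definition omega (M : nat -> R) : Rbar :=
  LimInf_seq (fun p => ln (quotients M p) / ln (INR p)).

(* The supremum is finite for every t > 0 as soon as the quotients of M tend
   to infinity, so that [real] only strips the constructor [Finite]. *)
Definition assoc_fun (M : nat -> R) (t : R) : R :=
  real (Sup_seq (fun p => Finite (ln (t ^ p / M p)))).

Definition d_fun (M : nat -> R) (t : R) : R := ln (assoc_fun M t) / ln t.

Definition left_derivative (rho : R -> R) (r l : R) : Prop :=
  filterlim (fun h => (rho (r + h) - rho r) / h) (at_left 0) (locally l).

Definition right_derivative (rho : R -> R) (r l : R) : Prop :=
  filterlim (fun h => (rho (r + h) - rho r) / h) (at_right 0) (locally l).

(* Not every term of the sequence s has to be a point of non-differentiability,
   so finitely many exceptional points, or none at all, are allowed. *)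
Definition piecewise_C1 (c : R) (rho : R -> R) : Prop :=
  exists s : nat -> R,
    is_lim_seq s p_infty /\
    forall r, c < r ->
      (ex_derive rho r /\ continuous (Derive rho) r) \/
      ((exists n, r = s n) /\
       exists l1 l2, left_derivative rho r l1 /\ right_derivative rho r l2 /\
                     l1 <> l2).

(* In the last clause the limit is taken along the points where the derivative
   exists, since [Derive] has an arbitrary value at the other ones. *)
Definition proximate_order (rho : R -> R) (l : R) : Prop :=
  exists c : R,
    0 <= c /\
    (forall r, c < r -> continuous rho r) /\
    piecewise_C1 c rho /\
    (forall r, c < r -> 0 <= rho r) /\
    is_lim rho p_infty l /\
    filterlim (fun r => r * Derive rho r * ln r)
      (within (fun r => ex_derive rho r) (Rbar_locally p_infty)) (locally 0).

Definition admits_nonzero_proximate_order (M : nat -> R) : Prop :=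
  exists (rho : R -> R) (l : R),
    proximate_order rho l /\ 0 < l /\
    exists A B : R,
      Rbar_locally p_infty
        (fun t => A <= ln t * (rho t - d_fun M t) <= B).

(* D is the domain of definition of f. *)
Definition flat_in_direction (M : nat -> R) (D : logsurf -> Prop)
    (f : logsurf -> C) (theta : R) : Prop :=
  exists r K A : R,
    0 < r /\ 0 < K /\ 0 < A /\
    forall z, arg z = theta -> modulus z <= r ->
      D z /\ forall p : nat, Cmod (f z) <= K * A ^ p * M p * modulus z ^ p.

(* Main.v *)
(* In the logarithmic coordinate w = x + i y the sector is the strip |y| < a with
   a = pi gamma / 2.  Fix a point x + i y of the closed smaller sector and put
   m = M(t) with t proportional to e^(-x).  Since M is nondecreasing, flatness in
   direction a gives |f| <= K e^(-m) on the whole part of the upper side at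
   horizontal distance at most 2 a from the point, while f is bounded on the other
   sides of that rectangle.  Comparison with a cubic harmonic polynomial (a crude
   bound for the harmonic measure of the upper side) yields
   |f(x + i y)| <= 2 K e^(-c m) with c > 0 depending on delta and gamma only.  As M
   is comparable to t^rho(t) for a nonzero proximate order rho(t), the factor c can
   be absorbed: M(lambda t) <= c M(t) for some lambda > 0 and all large t.

   The maximum principle is derived from Goursat's theorem for rectangles. *)
Require Import Defs.
From Stdlib Require Import Reals Lra Lia ClassicalEpsilon.
From Coquelicot Require Import Coquelicot.
Open Scope R_scope.

(** * Goursat's theorem for rectangles *)

(** The comparison takes place on a bounded rectangle, where the maximum principle applies directly.
    The price is that flatness is used at moduli up to [exp (PI * gamma)] times that of the point;
    this fixed factor enters [k2] together with [/ lambda]. Points of large modulus are covered by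
    boundedness, at the cost of a factor in [k1].

    Since f is only continuous up to the upper side, the rectangle is shrunk into the open strip;
    uniform continuity loses a factor 2 on its top side, which is the 2 in 2 K.

    Complex line integrals are kept real: the imaginary part of F dw is a real one-form P dx + Q dy.
    The maximum principle rests on a bound of |F(w0)| by C0 times the maximum of |F| on the
    boundary, where C0 depends on the rectangle and w0 but not on F. Positivity of the imaginary
    part of the integral of dw / (w - w0) suffices for such a bound. *)

Lemma nested_segments (u : nat -> R) (W : R) :
  (forall n, u n <= u (S n)) ->
  (forall n, u (S n) + W / 2 ^ (S n) <= u n + W / 2 ^ n) ->
  0 <= W ->
  exists l, forall n, u n <= l <= u n + W / 2 ^ n.
Proof.
intros Hi Hd HW.
assert (Hp : forall n, 0 <= W / 2 ^ n).
{ intros n; apply Rdiv_le_0_compat; [easy|apply pow_lt; lra]. }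
assert (Hm : forall n k, u n <= u (n + k)%nat /\
   u (n + k)%nat + W / 2 ^ (n + k) <= u n + W / 2 ^ n).
{ intros n k; induction k as [|k [IH1 IH2]].
  - rewrite Nat.add_0_r; lra.
  - rewrite Nat.add_succ_r.
    generalize (Hi (n + k)%nat) (Hd (n + k)%nat); lra. }
destruct (ex_finite_lim_seq_incr u (u 0%nat + W / 2 ^ 0)) as [l Hl].
- exact Hi.
- intros n; generalize (Hm 0%nat n) (Hp n); simpl (0 + n)%nat; lra.
- exists l; intros n; split.
  + now apply is_lim_seq_incr_compare.
  + apply (is_lim_seq_le_loc u (fun _ => u n + W / 2 ^ n) l (u n + W / 2 ^ n)).
    * exists n; intros m Hnm.
      replace m with (n + (m - n))%nat by lia.
      generalize (Hm n (m - n)%nat) (Hp (n + (m - n))%nat); lra.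
    * exact Hl.
    * apply is_lim_seq_const.
Qed.

(** [B a c n] speaks of the rectangle with lower left corner (a, c) and sides [W / 2 ^ n],
    [H / 2 ^ n]; the numbers i and j select one of its four quarters. The lower left corners of the
    selected rectangles converge to a point common to all of them. *)
Lemma bisect_rectangle (B : R -> R -> nat -> Prop) (W H a0 c0 : R) :
  0 <= W -> 0 <= H ->
  (forall a c n, B a c n -> exists i j : R, (i = 0 \/ i = 1) /\ (j = 0 \/ j = 1) /\
     B (a + i * (W / 2 ^ S n)) (c + j * (H / 2 ^ S n)) (S n)) ->
  B a0 c0 0%nat ->
  exists x y, a0 <= x <= a0 + W /\ c0 <= y <= c0 + H /\
    forall n, exists a c, B a c n /\ a0 <= a /\ a + W / 2 ^ n <= a0 + W /\
      c0 <= c /\ c + H / 2 ^ n <= c0 + H /\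
      a <= x <= a + W / 2 ^ n /\ c <= y <= c + H / 2 ^ n.
Proof.
intros HW HH Hstep H0.
(* Each corner is carried with its proof of [B], since the choice of the next quarter depends on
   that proof. *)
pose (next := fun n (s : {p : R * R | B (fst p) (snd p) n}) =>
  match constructive_indefinite_description _ (Hstep _ _ n (proj2_sig s)) with
  | exist i Hi => match constructive_indefinite_description _ Hi with
    | exist j Hj => exist (fun p => B (fst p) (snd p) (S n))
      (fst (proj1_sig s) + i * (W / 2 ^ S n), snd (proj1_sig s) + j * (H / 2 ^ S n))
      (proj2 (proj2 Hj))
    end end).
pose (seq := fix seq n : {p : R * R | B (fst p) (snd p) n} :=
  match n with
  | O => exist (fun p => B (fst p) (snd p) 0%nat) (a0, c0) H0
  | S n => next n (seq n) end).
assert (Hs : forall n, exists i j, (i = 0 \/ i = 1) /\ (j = 0 \/ j = 1) /\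
  fst (proj1_sig (seq (S n))) = fst (proj1_sig (seq n)) + i * (W / 2 ^ S n) /\
  snd (proj1_sig (seq (S n))) = snd (proj1_sig (seq n)) + j * (H / 2 ^ S n)).
{ intros n; change (seq (S n)) with (next n (seq n)); unfold next.
  destruct (constructive_indefinite_description _ _) as [i Hi].
  destruct (constructive_indefinite_description _ _) as [j Hj].
  exists i, j; simpl proj1_sig; tauto. }
assert (Hhalf : forall V n, V / 2 ^ n = 2 * (V / 2 ^ S n)).
{ intros V n; simpl; field; apply pow_nonzero; lra. }
assert (Hpos : forall V n, 0 <= V -> 0 <= V / 2 ^ n).
{ intros V n HV; apply Rdiv_le_0_compat; [easy|apply pow_lt; lra]. }
destruct (nested_segments (fun n => fst (proj1_sig (seq n))) W) as [x Hx]; try easy.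
{ intros n; destruct (Hs n) as (i & j & Hi & Hj & -> & _).
  generalize (Hpos W (S n) HW); destruct Hi as [-> | ->]; lra. }
{ intros n; destruct (Hs n) as (i & j & Hi & Hj & -> & _).
  rewrite (Hhalf W n); generalize (Hpos W (S n) HW); destruct Hi as [-> | ->]; lra. }
destruct (nested_segments (fun n => snd (proj1_sig (seq n))) H) as [y Hy]; try easy.
{ intros n; destruct (Hs n) as (i & j & Hi & Hj & _ & ->).
  generalize (Hpos H (S n) HH); destruct Hj as [-> | ->]; lra. }
{ intros n; destruct (Hs n) as (i & j & Hi & Hj & _ & ->).
  rewrite (Hhalf H n); generalize (Hpos H (S n) HH); destruct Hj as [-> | ->]; lra. }
assert (Hin : forall n, a0 <= fst (proj1_sig (seq n)) /\
  fst (proj1_sig (seq n)) + W / 2 ^ n <= a0 + W /\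
  c0 <= snd (proj1_sig (seq n)) /\ snd (proj1_sig (seq n)) + H / 2 ^ n <= c0 + H).
{ induction n as [|n IH].
  - simpl; lra.
  - destruct (Hs n) as (i & j & Hi & Hj & -> & ->).
    rewrite (Hhalf W n), (Hhalf H n) in IH.
    generalize (Hpos W (S n) HW) (Hpos H (S n) HH).
    destruct Hi as [-> | ->]; destruct Hj as [-> | ->]; lra. }
exists x, y; split; [|split].
- generalize (Hx 0%nat); simpl; lra.
- generalize (Hy 0%nat); simpl; lra.
- intros n; exists (fst (proj1_sig (seq n))), (snd (proj1_sig (seq n))).
  split; [apply (proj2_sig (seq n))|].
  generalize (Hin n) (Hx n) (Hy n); tauto.
Qed.

(** The counterclockwise integral of P dx + Q dy over the boundary of [a, b] x [c, d]. *)
Definition boundary_integral (P Q : R -> R -> R) (a b c d : R) : R :=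
  RInt (fun x => P x c) a b - RInt (fun x => P x d) a b
  + RInt (fun y => Q b y) c d - RInt (fun y => Q a y) c d.

(** The shared number k says that the derivative of P in y equals that of Q in x. Only
    differentiability at the point is asked, with no continuity of the partial derivatives, as in
    Goursat's setting. *)
Definition closed_form_at (P Q : R -> R -> R) (x y : R) : Prop :=
  exists p k q, differentiable_pt_lim P x y p k /\ differentiable_pt_lim Q x y k q.

Lemma continuity_2d_pt_fst (P : R -> R -> R) (x y : R) :
  continuity_2d_pt P x y -> continuous (fun t => P t y) x.
Proof.
intros HP; apply filterlim_locally; intros eps.
exact (locally_2d_1d_const_y _ _ _ (HP eps)).
Qed.

Lemma continuity_2d_pt_snd (P : R -> R -> R) (x y : R) :
  continuity_2d_pt P x y -> continuous (fun t => P x t) y.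
Proof.
intros HP; apply filterlim_locally; intros eps.
exact (locally_2d_1d_const_x _ _ _ (HP eps)).
Qed.

Lemma closed_form_at_continuity (P Q : R -> R -> R) (x y : R) :
  closed_form_at P Q x y -> continuity_2d_pt P x y /\ continuity_2d_pt Q x y.
Proof.
intros (p & k & q & HP & HQ); split; apply differentiable_continuity_pt.
- now exists p, k.
- now exists k, q.
Qed.

Lemma ex_RInt_fst (P : R -> R -> R) (a b c : R) : a <= b ->
  (forall x, a <= x <= b -> continuity_2d_pt P x c) -> ex_RInt (fun x => P x c) a b.
Proof.
intros Hab HP; apply (ex_RInt_continuous (V := R_CompleteNormedModule)); intros x Hx.
rewrite Rmin_left, Rmax_right in Hx by easy.
now apply continuity_2d_pt_fst, HP.
Qed.

Lemma ex_RInt_snd (P : R -> R -> R) (a c d : R) : c <= d ->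
  (forall y, c <= y <= d -> continuity_2d_pt P a y) -> ex_RInt (fun y => P a y) c d.
Proof.
intros Hcd HP; apply (ex_RInt_continuous (V := R_CompleteNormedModule)); intros y Hy.
rewrite Rmin_left, Rmax_right in Hy by easy.
now apply continuity_2d_pt_snd, HP.
Qed.

Lemma boundary_integral_split_x (P Q : R -> R -> R) (a e b c d : R) :
  a <= e <= b ->
  (forall x, a <= x <= b -> continuity_2d_pt P x c /\ continuity_2d_pt P x d) ->
  boundary_integral P Q a b c d
  = boundary_integral P Q a e c d + boundary_integral P Q e b c d.
Proof.
intros He HP; unfold boundary_integral.
rewrite <- (RInt_Chasles (fun x => P x c) a e b), <- (RInt_Chasles (fun x => P x d) a e b);
  try (apply ex_RInt_fst; [lra|intros x Hx; apply HP; lra]).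
unfold plus; simpl; ring.
Qed.

Lemma boundary_integral_split_y (P Q : R -> R -> R) (a b c e d : R) :
  c <= e <= d ->
  (forall y, c <= y <= d -> continuity_2d_pt Q a y /\ continuity_2d_pt Q b y) ->
  boundary_integral P Q a b c d
  = boundary_integral P Q a b c e + boundary_integral P Q a b e d.
Proof.
intros He HQ; unfold boundary_integral.
rewrite <- (RInt_Chasles (fun y => Q a y) c e d), <- (RInt_Chasles (fun y => Q b y) c e d);
  try (apply ex_RInt_snd; [lra|intros x Hx; apply HQ; lra]).
unfold plus; simpl; ring.
Qed.

Lemma RInt_near_const (phi : R -> R) (a b k e : R) : a <= b -> ex_RInt phi a b ->
  (forall x, a <= x <= b -> Rabs (phi x - k) <= e) ->
  Rabs (RInt phi a b - k * (b - a)) <= (b - a) * e.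
Proof.
intros Hab Hphi He.
replace (RInt phi a b - k * (b - a)) with (RInt (fun x => minus (phi x) k) a b).
- apply abs_RInt_le_const; try easy.
  apply (ex_RInt_minus (V := R_NormedModule)); [easy|apply ex_RInt_const].
- rewrite (RInt_minus (V := R_CompleteNormedModule) phi (fun _ => k)); [|easy|apply ex_RInt_const].
  rewrite RInt_const; unfold minus, plus, opp, scal; simpl; unfold mult; simpl; ring.
Qed.

(** The affine parts of P and Q at (x, y) form a closed form, whose boundary integral is 0. What
    remains is the length of the sides times an error that is small compared with their length. *)
Lemma boundary_integral_local (P Q : R -> R -> R) (x y : R) : closed_form_at P Q x y ->
  forall eps : posreal, exists delta : posreal, forall a b c d,
  a <= x <= b -> c <= y <= d -> b - a < delta -> d - c < delta ->
  (forall u v, a <= u <= b -> c <= v <= d ->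
     continuity_2d_pt P u v /\ continuity_2d_pt Q u v) ->
  Rabs (boundary_integral P Q a b c d) <= eps * (b - a + (d - c)) ^ 2.
Proof.
intros (p & k & q & HP & HQ) eps.
assert (He : 0 < eps / 2) by (generalize (cond_pos eps); lra).
destruct (HP (mkposreal _ He)) as [d1 H1].
destruct (HQ (mkposreal _ He)) as [d2 H2].
exists (mkposreal _ (Rmin_pos _ _ (cond_pos d1) (cond_pos d2))); simpl.
intros a b c d Hx Hy Hab Hcd Hc.
assert (Hd1 := Rmin_l d1 d2); assert (Hd2 := Rmin_r d1 d2).
set (m := b - a + (d - c)).
assert (Hloc : forall u v, a <= u <= b -> c <= v <= d ->
  Rabs (P u v - P x y - (p * (u - x) + k * (v - y))) <= eps / 2 * m /\
  Rabs (Q u v - Q x y - (k * (u - x) + q * (v - y))) <= eps / 2 * m).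
{ intros u v Hu Hv.
  assert (Hux : Rabs (u - x) <= b - a) by (apply Rabs_le; lra).
  assert (Hvy : Rabs (v - y) <= d - c) by (apply Rabs_le; lra).
  assert (Hmax : Rmax (Rabs (u - x)) (Rabs (v - y)) <= m)
    by (unfold m; apply Rmax_lub; lra).
  split; (eapply Rle_trans; [|apply Rmult_le_compat_l; [lra|exact Hmax]]).
  - apply H1; lra.
  - apply H2; lra. }
(* In the difference of two opposite sides the affine part reduces to a constant; the constants from
   [HIP] and [HIQ] are k times the area with opposite signs. *)
assert (HIP : Rabs (RInt (fun x => P x c) a b - RInt (fun x => P x d) a b
   - k * (c - d) * (b - a)) <= (b - a) * (eps * m)).
{ assert (E : forall v, c <= v <= d -> ex_RInt (fun x => P x v) a b).
  { intros v Hv; apply ex_RInt_fst; [lra|intros; apply Hc; lra]. }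
  change (RInt (fun x => P x c) a b - RInt (fun x => P x d) a b)
    with (minus (RInt (fun x => P x c) a b) (RInt (fun x => P x d) a b)).
  rewrite <- (RInt_minus (V := R_CompleteNormedModule)) by (apply E; lra).
  apply RInt_near_const; [lra| |].
  - apply (ex_RInt_minus (V := R_NormedModule)); apply E; lra.
  - intros u Hu.
    destruct (Hloc u c) as [Huc _]; try lra.
    destruct (Hloc u d) as [Hud _]; try lra.
    unfold minus, plus, opp; simpl.
    apply Rabs_le_between in Huc; apply Rabs_le_between in Hud; apply Rabs_le; lra. }
assert (HIQ : Rabs (RInt (fun y => Q b y) c d - RInt (fun y => Q a y) c d
   - k * (b - a) * (d - c)) <= (d - c) * (eps * m)).
{ assert (E : forall u, a <= u <= b -> ex_RInt (fun y => Q u y) c d).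
  { intros v Hv; apply ex_RInt_snd; [lra|intros; apply Hc; lra]. }
  change (RInt (fun y => Q b y) c d - RInt (fun y => Q a y) c d)
    with (minus (RInt (fun y => Q b y) c d) (RInt (fun y => Q a y) c d)).
  rewrite <- (RInt_minus (V := R_CompleteNormedModule)) by (apply E; lra).
  apply RInt_near_const; [lra| |].
  - apply (ex_RInt_minus (V := R_NormedModule)); apply E; lra.
  - intros v Hv.
    destruct (Hloc a v) as [_ Huc]; try lra.
    destruct (Hloc b v) as [_ Hud]; try lra.
    unfold minus, plus, opp; simpl.
    apply Rabs_le_between in Huc; apply Rabs_le_between in Hud; apply Rabs_le; lra. }
unfold boundary_integral.
assert (Em : eps * m ^ 2 = (b - a) * (eps * m) + (d - c) * (eps * m)) by (unfold m; ring).
apply Rabs_le_between in HIP; apply Rabs_le_between in HIQ.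
clearbody m; apply Rabs_le; lra.
Qed.

(** The integral is the sum of those over the four quarters, so a nonzero value leaves at least a
    fourth of its size on some quarter. Repeated, this decays like [/ 4 ^ n], whereas the local
    estimate at the limit point gives an arbitrarily small multiple of [/ 4 ^ n]. *)
Theorem goursat_rectangle (P Q : R -> R -> R) (a b c d : R) : a < b -> c < d ->
  (forall x y, a <= x <= b -> c <= y <= d -> closed_form_at P Q x y) ->
  boundary_integral P Q a b c d = 0.
Proof.
intros Hab Hcd HF.
set (W := b - a); set (H := d - c).
assert (HW : 0 < W) by (unfold W; lra); assert (HH : 0 < H) by (unfold H; lra).
assert (HC : forall x y, a <= x <= b -> c <= y <= d ->
  continuity_2d_pt P x y /\ continuity_2d_pt Q x y).
{ intros x y Hx Hy; now apply closed_form_at_continuity, HF. }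
set (eta := Rabs (boundary_integral P Q a b c d)).
destruct (Rle_lt_dec eta 0) as [H0|H0].
{ assert (Heta : eta = 0) by (generalize (Rabs_pos (boundary_integral P Q a b c d)); unfold eta in *; lra).
  destruct (Req_dec (boundary_integral P Q a b c d) 0) as [|Hn]; [easy|].
  now apply Rabs_no_R0 in Hn. }
exfalso.
pose (bad := fun a' c' n => a <= a' /\ a' + W / 2 ^ n <= b /\ c <= c' /\ c' + H / 2 ^ n <= d /\
  eta / 4 ^ n <= Rabs (boundary_integral P Q a' (a' + W / 2 ^ n) c' (c' + H / 2 ^ n))).
assert (Hhalf : forall V n, V / 2 ^ n = 2 * (V / 2 ^ S n)).
{ intros V n; simpl; field; apply pow_nonzero; lra. }
assert (Hpos : forall V n, 0 < V -> 0 < V / 2 ^ n).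
{ intros V n HV; apply Rdiv_lt_0_compat; [easy|apply pow_lt; lra]. }
destruct (bisect_rectangle bad W H a c) as (x & y & Hx & Hy & Hn); try lra.
- intros a' c' n (Ha1 & Ha2 & Hc1 & Hc2 & HB).
  rewrite (Hhalf W n) in Ha2, HB; rewrite (Hhalf H n) in Hc2, HB.
  assert (Hw := Hpos W (S n) HW); assert (Hh := Hpos H (S n) HH).
  set (w := W / 2 ^ S n) in *; set (h := H / 2 ^ S n) in *.
  assert (E4 : eta / 4 ^ n = 4 * (eta / 4 ^ S n)) by (simpl; field; apply pow_nonzero; lra).
  rewrite E4 in HB.
  rewrite (boundary_integral_split_x P Q a' (a' + w)) in HB;
    [|lra|intros; split; apply HC; lra].
  rewrite (boundary_integral_split_y P Q a' (a' + w) c' (c' + h)) in HB;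
    [|lra|intros; split; apply HC; lra].
  rewrite (boundary_integral_split_y P Q (a' + w) (a' + 2 * w) c' (c' + h)) in HB;
    [|lra|intros; split; apply HC; lra].
  destruct (Rle_lt_dec (eta / 4 ^ S n) (Rabs (boundary_integral P Q a' (a' + w) c' (c' + h)))) as [H1|H1].
  { exists 0, 0; split; [tauto|split; [tauto|]]; unfold bad.
    fold w h; rewrite !Rmult_0_l, !Rplus_0_r; repeat split; lra. }
  destruct (Rle_lt_dec (eta / 4 ^ S n) (Rabs (boundary_integral P Q a' (a' + w) (c' + h) (c' + 2 * h)))) as [H2|H2].
  { exists 0, 1; split; [tauto|split; [tauto|]]; unfold bad.
    fold w h; rewrite !Rmult_0_l, !Rplus_0_r, !Rmult_1_l, (Rplus_assoc c'), Rplus_diag.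
    repeat split; lra. }
  destruct (Rle_lt_dec (eta / 4 ^ S n) (Rabs (boundary_integral P Q (a' + w) (a' + 2 * w) c' (c' + h)))) as [H3|H3].
  { exists 1, 0; split; [tauto|split; [tauto|]]; unfold bad.
    fold w h; rewrite !Rmult_0_l, !Rplus_0_r, !Rmult_1_l, (Rplus_assoc a'), Rplus_diag.
    repeat split; lra. }
  destruct (Rle_lt_dec (eta / 4 ^ S n) (Rabs (boundary_integral P Q (a' + w) (a' + 2 * w) (c' + h) (c' + 2 * h)))) as [H4|H4].
  { exists 1, 1; split; [tauto|split; [tauto|]]; unfold bad.
    fold w h; rewrite !Rmult_1_l, (Rplus_assoc a'), (Rplus_assoc c'), !Rplus_diag.
    repeat split; lra. }
  exfalso; revert HB; apply Rlt_not_le.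
  apply Rabs_def2 in H1; apply Rabs_def2 in H2; apply Rabs_def2 in H3; apply Rabs_def2 in H4.
  apply Rabs_def1; lra.
- unfold bad; simpl; rewrite !Rdiv_1_r.
  replace (a + W) with b by (unfold W; ring); replace (c + H) with d by (unfold H; ring).
  unfold eta; repeat split; lra.
(* With this eps the local estimate gives half of the lower bound [eta / 4 ^ n]. *)
- assert (He : 0 < eta / (2 * (W + H) ^ 2)).
  { apply Rdiv_lt_0_compat; [easy|]; apply Rmult_lt_0_compat; [lra|apply pow_lt; lra]. }
  assert (Hxy : closed_form_at P Q x y) by (apply HF; unfold W, H in *; lra).
  destruct (boundary_integral_local P Q x y Hxy (mkposreal _ He)) as [delta Hdelta].
  assert (Hlim : exists n, (W + H) / 2 ^ n < delta).
  { destruct (pow_lt_1_zero (/ 2)) with (y := delta / (W + H)) as [n Hn'].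
    - rewrite Rabs_pos_eq; lra.
    - apply Rdiv_lt_0_compat; [apply cond_pos|lra].
    - exists n; specialize (Hn' n (le_n n)).
      rewrite Rabs_pos_eq in Hn' by (apply pow_le; lra).
      apply (Rmult_lt_compat_r (W + H)) in Hn'; [|lra].
      replace (delta / (W + H) * (W + H)) with (pos delta) in Hn' by (field; lra).
      rewrite pow_inv in Hn'.
      unfold Rdiv; lra. }
  destruct Hlim as [n Hlim].
  destruct (Hn n) as (a' & c' & (Ha1 & Ha2 & Hc1 & Hc2 & HB) & _ & _ & _ & _ & Hxn & Hyn).
  assert (Hw := Hpos W n HW); assert (Hh := Hpos H n HH).
  assert (Es : (W + H) / 2 ^ n = W / 2 ^ n + H / 2 ^ n) by (unfold Rdiv; ring).
  assert (Hlast := Hdelta a' (a' + W / 2 ^ n) c' (c' + H / 2 ^ n) Hxn Hyn).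
  simpl in Hlast.
  assert (Hfin : Rabs (boundary_integral P Q a' (a' + W / 2 ^ n) c' (c' + H / 2 ^ n)) <= eta / 4 ^ n / 2).
  { eapply Rle_trans; [apply Hlast; try lra; intros; apply HC; lra|].
    apply Req_le.
    replace 4 with (2 * 2) by ring; rewrite Rpow_mult_distr.
    field; split; [apply pow_nonzero|]; lra. }
  assert (0 < eta / 4 ^ n) by (apply Rdiv_lt_0_compat; [easy|apply pow_lt; lra]).
  lra.
Qed.

Lemma boundary_integral_bound (P Q : R -> R -> R) (a b c d B : R) : a <= b -> c <= d ->
  (forall x, a <= x <= b -> continuity_2d_pt P x c /\ continuity_2d_pt P x d /\
     Rabs (P x c) <= B /\ Rabs (P x d) <= B) ->
  (forall y, c <= y <= d -> continuity_2d_pt Q a y /\ continuity_2d_pt Q b y /\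
     Rabs (Q a y) <= B /\ Rabs (Q b y) <= B) ->
  Rabs (boundary_integral P Q a b c d) <= 2 * (b - a + (d - c)) * B.
Proof.
intros Hab Hcd HP HQ; unfold boundary_integral.
assert (H1 := abs_RInt_le_const (fun x => P x c) a b B Hab
  (ex_RInt_fst P a b c Hab (fun x Hx => proj1 (HP x Hx)))
  (fun x Hx => proj1 (proj2 (proj2 (HP x Hx))))).
assert (H2 := abs_RInt_le_const (fun x => P x d) a b B Hab
  (ex_RInt_fst P a b d Hab (fun x Hx => proj1 (proj2 (HP x Hx))))
  (fun x Hx => proj2 (proj2 (proj2 (HP x Hx))))).
assert (H3 := abs_RInt_le_const (fun y => Q a y) c d B Hcd
  (ex_RInt_snd Q a c d Hcd (fun y Hy => proj1 (HQ y Hy)))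
  (fun y Hy => proj1 (proj2 (proj2 (HQ y Hy))))).
assert (H4 := abs_RInt_le_const (fun y => Q b y) c d B Hcd
  (ex_RInt_snd Q b c d Hcd (fun y Hy => proj1 (proj2 (HQ y Hy))))
  (fun y Hy => proj2 (proj2 (proj2 (HQ y Hy))))).
apply Rabs_le_between in H1; apply Rabs_le_between in H2.
apply Rabs_le_between in H3; apply Rabs_le_between in H4.
apply Rabs_le; lra.
Qed.

(** Continuity is asked on the sides only, because the forms to be combined are singular at an
    interior point. *)
Lemma boundary_integral_combine (P Q P0 Q0 : R -> R -> R) (s a b c d : R) :
  a <= b -> c <= d ->
  (forall x y, a <= x <= b -> y = c \/ y = d ->
     continuity_2d_pt P x y /\ continuity_2d_pt P0 x y) ->
  (forall x y, x = a \/ x = b -> c <= y <= d ->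
     continuity_2d_pt Q x y /\ continuity_2d_pt Q0 x y) ->
  boundary_integral (fun x y => P x y - s * P0 x y) (fun x y => Q x y - s * Q0 x y) a b c d
  = boundary_integral P Q a b c d - s * boundary_integral P0 Q0 a b c d.
Proof.
intros Hab Hcd HP HQ; unfold boundary_integral.
assert (L : forall (g h : R -> R) u v, ex_RInt g u v -> ex_RInt h u v ->
  RInt (fun t => g t - s * h t) u v = RInt g u v - s * RInt h u v).
{ intros g h u v Hg Hh.
  change (fun t => g t - s * h t) with (fun t => minus (g t) (scal s (h t))).
  rewrite (RInt_minus (V := R_CompleteNormedModule) g); [|easy|now apply (ex_RInt_scal h)].
  rewrite (RInt_scal (V := R_CompleteNormedModule) h); [|easy].
  reflexivity. }
rewrite (L (fun x => P x c) (fun x => P0 x c)), (L (fun x => P x d) (fun x => P0 x d)),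
  (L (fun y => Q a y) (fun y => Q0 a y)), (L (fun y => Q b y) (fun y => Q0 b y)).
- ring.
- apply ex_RInt_snd; [easy|intros y Hy; apply HQ; tauto].
- apply ex_RInt_snd; [easy|intros y Hy; apply HQ; tauto].
- apply ex_RInt_snd; [easy|intros y Hy; apply HQ; tauto].
- apply ex_RInt_snd; [easy|intros y Hy; apply HQ; tauto].
- apply ex_RInt_fst; [easy|intros x Hx; apply HP; tauto].
- apply ex_RInt_fst; [easy|intros x Hx; apply HP; tauto].
- apply ex_RInt_fst; [easy|intros x Hx; apply HP; tauto].
- apply ex_RInt_fst; [easy|intros x Hx; apply HP; tauto].
Qed.

(** A square of half side r around the puncture is cut out. The four surrounding rectangles
    contribute 0, and the square at most its perimeter 8 r times B, which tends to 0 with r. *)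
Lemma goursat_rectangle_punctured (P Q : R -> R -> R) (a b c d x0 y0 B delta : R) :
  a < x0 < b -> c < y0 < d -> 0 < delta ->
  (forall x y, a <= x <= b -> c <= y <= d -> (x, y) <> (x0, y0) -> closed_form_at P Q x y) ->
  (forall x y, Rabs (x - x0) < delta -> Rabs (y - y0) < delta -> (x, y) <> (x0, y0) ->
     Rabs (P x y) <= B /\ Rabs (Q x y) <= B) ->
  boundary_integral P Q a b c d = 0.
Proof.
intros Hx0 Hy0 Hd HF HB.
assert (HC : forall x y, a <= x <= b -> c <= y <= d -> (x <> x0 \/ y <> y0) ->
  closed_form_at P Q x y /\ continuity_2d_pt P x y /\ continuity_2d_pt Q x y).
{ intros x y Hx Hy Hne.
  assert (HFxy : closed_form_at P Q x y).
  { apply HF; try easy; intros E; injection E; intros; destruct Hne; easy. }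
  split; [easy|now apply closed_form_at_continuity]. }
assert (Hsmall : forall r, 0 < r -> r < x0 - a -> r < b - x0 -> r < y0 - c -> r < d - y0 ->
  r < delta -> Rabs (boundary_integral P Q a b c d) <= 8 * r * B).
{ intros r Hr H1 H2 H3 H4 H5.
  rewrite (boundary_integral_split_x P Q a (x0 - r) b c d);
    [|lra|intros; split; apply HC; lra].
  rewrite (boundary_integral_split_x P Q (x0 - r) (x0 + r) b c d);
    [|lra|intros; split; apply HC; lra].
  rewrite (boundary_integral_split_y P Q (x0 - r) (x0 + r) c (y0 - r) d);
    [|lra|intros; split; apply HC; lra].
  rewrite (boundary_integral_split_y P Q (x0 - r) (x0 + r) (y0 - r) (y0 + r) d);
    [|lra|intros; split; apply HC; lra].
  rewrite (goursat_rectangle P Q a (x0 - r)), (goursat_rectangle P Q (x0 + r) b),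
    (goursat_rectangle P Q (x0 - r) (x0 + r) c), (goursat_rectangle P Q (x0 - r) (x0 + r) (y0 + r) d);
    try lra; try (intros; apply HC; lra).
  rewrite !Rplus_0_l, !Rplus_0_r.
  replace (8 * r * B) with (2 * (x0 + r - (x0 - r) + (y0 + r - (y0 - r))) * B) by ring.
  apply boundary_integral_bound; try lra.
  - intros x Hx; split; [apply HC; lra|split; [apply HC; lra|]].
    split; apply HB; try (apply Rabs_def1; lra); intros E; injection E; lra.
  - intros x Hx; split; [apply HC; lra|split; [apply HC; lra|]].
    split; apply HB; try (apply Rabs_def1; lra); intros E; injection E; lra. }
destruct (Req_dec (boundary_integral P Q a b c d) 0) as [|Hn]; [easy|exfalso].
apply Rabs_pos_lt in Hn; set (I := Rabs _) in *.
assert (HB0 : 0 <= B).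
{ destruct (HB (x0 + delta / 2) y0) as [HB' _].
  - apply Rabs_def1; lra.
  - apply Rabs_def1; lra.
  - intros E; injection E; lra.
  - eapply Rle_trans; [apply Rabs_pos|exact HB']. }
(* B may be 0, hence the denominator with B + 1. Half of the minimum [m] below makes all
   inequalities on r strict and forces I <= I / 2. *)
assert (HI : 0 < I / (8 * (B + 1))) by (apply Rdiv_lt_0_compat; lra).
set (m := Rmin (Rmin (x0 - a) (b - x0)) (Rmin (Rmin (y0 - c) (d - y0)) (Rmin delta (I / (8 * (B + 1)))))).
assert (Hm : 0 < m) by (unfold m; repeat apply Rmin_pos; lra).
assert (Hmle : m <= x0 - a /\ m <= b - x0 /\ m <= y0 - c /\ m <= d - y0 /\ m <= delta /\ m <= I / (8 * (B + 1))).
{ unfold m; clear.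
  set (q := I / _).
  repeat split; unfold Rmin; repeat destruct Rle_dec; lra. }
assert (Hf := Hsmall (m / 2)).
assert (I <= 8 * (m / 2) * B) by (apply Hf; lra).
assert (8 * (m / 2) * B <= 8 * (m / 2) * (B + 1)) by (apply Rmult_le_compat_l; lra).
assert (m * (8 * (B + 1)) <= I).
{ apply Rle_trans with (I / (8 * (B + 1)) * (8 * (B + 1))).
  - apply Rmult_le_compat_r; lra.
  - apply Req_le; field; lra. }
lra.
Qed.

(** * Complex differentiability and the maximum principle *)

(** Complex differentiability, with C taken as a module over itself so that norms and balls are
    those of [Cmod]. *)
Notation C_derivable F z :=
  (@ex_derive C_AbsRing (AbsRing_NormedModule C_AbsRing) F z).
Notation is_C_derive F z l :=
  (@is_derive C_AbsRing (AbsRing_NormedModule C_AbsRing) F z l).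

Lemma is_C_derive_iff (F : C -> C) (z l : C) :
  is_C_derive F z l <->
  forall eps : posreal, exists delta : posreal, forall w : C,
    Cmod (w - z) < delta -> Cmod (F w - F z - l * (w - z)) <= eps * Cmod (w - z).
Proof.
split.
- intros [_ HF] eps.
  specialize (HF z (fun P H => H) eps). 
  destruct HF as [delta Hd].
  exists delta; intros w Hw.
  specialize (Hd w Hw).
  rewrite (Cmult_comm l).
  exact Hd.
- intros HF; split; [exact (is_linear_scal_l (V := AbsRing_NormedModule C_AbsRing) l)|].
  intros z' Hz' eps.
  assert (E : z = z') by exact (is_filter_lim_locally_unique (V := AbsRing_NormedModule C_AbsRing) z z' Hz').
  subst z'.
  destruct (HF eps) as [delta Hd].
  exists delta; intros w Hw.
  specialize (Hd w Hw).
  rewrite (Cmult_comm l) in Hd.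
  exact Hd.
Qed.

Lemma Cmod_le_Rabs (z : C) : Cmod z <= Rabs (fst z) + Rabs (snd z).
Proof.
unfold Cmod; rewrite <- (sqrt_pow2 (Rabs (fst z) + Rabs (snd z))).
- apply sqrt_le_1_alt; rewrite <- (pow2_abs (fst z)), <- (pow2_abs (snd z)).
  generalize (Rmult_le_pos _ _ (Rabs_pos (fst z)) (Rabs_pos (snd z))); lra.
- generalize (Rabs_pos (fst z)) (Rabs_pos (snd z)); lra.
Qed.

Lemma C_derivable_const (c z : C) : C_derivable (fun _ => c) z.
Proof. exists zero; exact (is_derive_const (V := AbsRing_NormedModule C_AbsRing) c z). Qed.

Lemma C_derivable_id (z : C) : C_derivable (fun w : C => w) z.
Proof. exists one; exact (is_derive_id z). Qed.

Lemma C_derivable_minus (F G : C -> C) (z : C) :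
  C_derivable F z -> C_derivable G z -> C_derivable (fun w => F w - G w)%C z.
Proof. intros [l Hl] [m Hm]; eexists; exact (is_derive_minus (V := AbsRing_NormedModule C_AbsRing) F G z _ _ Hl Hm). Qed.

Lemma C_derivable_mult (F G : C -> C) (z : C) :
  C_derivable F z -> C_derivable G z -> C_derivable (fun w => F w * G w)%C z.
Proof. intros [l Hl] [m Hm]; eexists; exact (is_derive_mult F G z _ _ Hl Hm Cmult_comm). Qed.

Lemma C_derivable_comp (F G : C -> C) (z : C) :
  C_derivable F (G z) -> C_derivable G z -> C_derivable (fun w => F (G w)) z.
Proof. intros [l Hl] [m Hm]; eexists; exact (is_derive_comp (V := AbsRing_NormedModule C_AbsRing) F G z _ _ Hl Hm). Qed.

Lemma C_derivable_pow (F : C -> C) (z : C) (n : nat) :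
  C_derivable F z -> C_derivable (fun w => Cpow (F w) n) z.
Proof.
intros HF; induction n as [|n IH].
- exact (C_derivable_const (RtoC 1) z).
- exact (C_derivable_mult _ _ z HF IH).
Qed.

Lemma C_derivable_inv (z0 z : C) : z <> z0 -> C_derivable (fun w => / (w - z0))%C z.
Proof.
intros Hz.
assert (Hr : 0 < Cmod (z - z0)) by (apply Cmod_gt_0; now apply Cminus_eq_contra).
set (r := Cmod (z - z0)) in *.
exists (- / ((z - z0) * (z - z0)))%C; apply is_C_derive_iff; intros eps.
(* The remainder is exactly (w - z)^2 / ((w - z0) (z - z0)^2). The first bound keeps |w - z0| above
   r / 2, the second then makes the remainder at most eps |w - z|. *)
assert (Hd : 0 < Rmin (r / 2) (eps * r ^ 3 / 2)).
{ apply Rmin_pos; [lra|].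
  generalize (Rmult_lt_0_compat _ _ (cond_pos eps) (pow_lt r 3 Hr)); lra. }
exists (mkposreal _ Hd); simpl; intros w Hw.
assert (Hw1 := Rlt_le_trans _ _ _ Hw (Rmin_l _ _)).
assert (Hw2 := Rlt_le_trans _ _ _ Hw (Rmin_r _ _)); clear Hw Hd.
assert (Hwr : r / 2 <= Cmod (w - z0)).
{ assert (T := Cmod_triangle (w - z0) (z - w)).
  replace (w - z0 + (z - w))%C with (z - z0)%C in T by ring.
  replace (z - w)%C with (- (w - z))%C in T by ring.
  rewrite Cmod_opp in T; fold r in T; lra. }
assert (Hn1 : (z - z0)%C <> 0) by (apply Cmod_gt_0; exact Hr).
assert (Hn2 : (w - z0)%C <> 0) by (apply Cmod_gt_0; lra).
replace (/ (w - z0) - / (z - z0) - - / ((z - z0) * (z - z0)) * (w - z))%C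
  with ((w - z) * (w - z) / ((w - z0) * ((z - z0) * (z - z0))))%C by (field; easy).
rewrite Cmod_div by (repeat apply Cmult_neq_0; easy).
rewrite !Cmod_mult; fold r.
apply Rle_div_l; [apply Rmult_lt_0_compat; [lra|now apply Rmult_lt_0_compat]|].
set (q := Cmod (w - z)) in *; set (s := Cmod (w - z0)) in *.
assert (Hq : 0 <= q) by apply Cmod_ge_0.
replace (eps * q * (s * (r * r))) with (q * (eps * (s * (r * r)))) by ring.
apply Rmult_le_compat_l; [easy|].
apply Rle_trans with (eps * (r / 2 * (r * r))).
- replace (eps * (r / 2 * (r * r))) with (eps * r ^ 3 / 2) by field; lra.
- apply Rmult_le_compat_l; [generalize (cond_pos eps); lra|].
  apply Rmult_le_compat_r; [|easy].
  apply Rmult_le_pos; lra.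
Qed.

(* Im (F dw) = (Im F) dx + (Re F) dy is closed by the Cauchy-Riemann equations. *)
Lemma C_derivable_closed_form (F : C -> C) (x y : R) : C_derivable F (x, y) ->
  closed_form_at (fun u v => snd (F (u, v))) (fun u v => fst (F (u, v))) x y.
Proof.
intros [[l1 l2] Hl0].
assert (Hl := proj1 (is_C_derive_iff F (x, y) (l1, l2)) Hl0).
assert (Hmain : forall eps : posreal, exists delta : posreal, forall u v,
  Rabs (u - x) < delta -> Rabs (v - y) < delta ->
  Cmod (F (u, v) - F (x, y) - (l1, l2) * ((u, v) - (x, y)))
    <= eps * Rmax (Rabs (u - x)) (Rabs (v - y))).
{ intros eps.
  destruct (Hl (pos_div_2 eps)) as [delta Hd].
  exists (pos_div_2 delta); simpl; intros u v Hu Hv.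
  assert (HC : Cmod ((u, v) - (x, y)) <= Rabs (u - x) + Rabs (v - y)).
  { exact (Cmod_le_Rabs ((u, v) - (x, y))). }
  eapply Rle_trans; [apply Hd; lra|simpl].
  assert (M1 := Rmax_l (Rabs (u - x)) (Rabs (v - y))).
  assert (M2 := Rmax_r (Rabs (u - x)) (Rabs (v - y))).
  replace (eps * Rmax (Rabs (u - x)) (Rabs (v - y)))
    with (eps / 2 * (2 * Rmax (Rabs (u - x)) (Rabs (v - y)))) by field.
  apply Rmult_le_compat_l; [generalize (cond_pos eps)|]; lra. }
exists l2, l1, (- l2); split; intros eps; destruct (Hmain eps) as [delta Hd];
  exists delta; intros u v Hu Hv; (eapply Rle_trans; [|exact (Hd u v Hu Hv)]).
- eapply Rle_trans; [|apply Rmax_Cmod]; eapply Rle_trans; [|apply Rmax_r].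
  apply Req_le, f_equal; simpl; ring.
- eapply Rle_trans; [|apply Rmax_Cmod]; eapply Rle_trans; [|apply Rmax_l].
  apply Req_le, f_equal; simpl; ring.
Qed.

Definition rectangle_boundary (a b c d : R) (z : C) : Prop :=
  (a <= fst z <= b /\ (snd z = c \/ snd z = d)) \/
  ((fst z = a \/ fst z = b) /\ c <= snd z <= d).

(** The value is 2 pi, the total turning of the argument around (x0, y0). Positivity can be read off
    side by side: on each of the four sides the argument increases in the counterclockwise
    direction, so the integrand has a constant sign. *)
Lemma cauchy_kernel_integral_pos (a b c d x0 y0 : R) : a < x0 < b -> c < y0 < d ->
  0 < boundary_integral (fun x y => snd (/ ((x, y) - (x0, y0)))%C)
        (fun x y => fst (/ ((x, y) - (x0, y0)))%C) a b c d.
Proof.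
intros Hx0 Hy0.
assert (HC : forall x y, (x <> x0 \/ y <> y0) ->
  continuity_2d_pt (fun x y => snd (/ ((x, y) - (x0, y0)))%C) x y /\
  continuity_2d_pt (fun x y => fst (/ ((x, y) - (x0, y0)))%C) x y).
{ intros x y Hne; apply closed_form_at_continuity.
  apply (C_derivable_closed_form (fun w => / (w - (x0, y0)))%C), C_derivable_inv.
  intros E; injection E; intros; destruct Hne; easy. }
assert (Hpos : forall x y, (x <> x0 \/ y <> y0) -> 0 < (x - x0) ^ 2 + (y - y0) ^ 2).
{ intros x y [H|H].
  - assert (0 < (x - x0) ^ 2) by (apply pow2_gt_0; lra).
    generalize (pow2_ge_0 (y - y0)); lra.
  - assert (0 < (y - y0) ^ 2) by (apply pow2_gt_0; lra).
    generalize (pow2_ge_0 (x - x0)); lra. }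
assert (H1 : 0 < RInt (fun x => snd (/ ((x, c) - (x0, y0)))%C) a b).
{ apply RInt_gt_0; [lra| |].
  - intros x Hx; simpl; apply Rdiv_lt_0_compat; [lra|apply (Hpos x c); lra].
  - intros x Hx; apply (continuity_2d_pt_fst (fun x y => snd (/ ((x, y) - (x0, y0)))%C)), HC; lra. }
assert (H2 : RInt (fun x => snd (/ ((x, d) - (x0, y0)))%C) a b < RInt (fun _ => 0) a b).
{ apply RInt_lt; [lra|intros; apply continuous_const| |].
  - intros x Hx; apply (continuity_2d_pt_fst (fun x y => snd (/ ((x, y) - (x0, y0)))%C)), HC; lra.
  - intros x Hx; simpl.
    assert (0 < - (- (d + - y0) / ((x + - x0) * ((x + - x0) * 1) + (d + - y0) * ((d + - y0) * 1)))); [|lra].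
    unfold Rdiv; rewrite <- Ropp_mult_distr_l, Ropp_involutive.
    apply Rdiv_lt_0_compat; [lra|apply (Hpos x d); lra]. }
assert (H3 : 0 < RInt (fun y => fst (/ ((b, y) - (x0, y0)))%C) c d).
{ apply RInt_gt_0; [lra| |].
  - intros y Hy; simpl; apply Rdiv_lt_0_compat; [lra|apply (Hpos b y); lra].
  - intros y Hy; apply (continuity_2d_pt_snd (fun x y => fst (/ ((x, y) - (x0, y0)))%C)), HC; lra. }
assert (H4 : RInt (fun y => fst (/ ((a, y) - (x0, y0)))%C) c d < RInt (fun _ => 0) c d).
{ apply RInt_lt; [lra|intros; apply continuous_const| |].
  - intros y Hy; apply (continuity_2d_pt_snd (fun x y => fst (/ ((x, y) - (x0, y0)))%C)), HC; lra.
  - intros y Hy; simpl.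
    assert (0 < - ((a + - x0) / ((a + - x0) * ((a + - x0) * 1) + (y + - y0) * ((y + - y0) * 1)))); [|lra].
    unfold Rdiv; rewrite Ropp_mult_distr_l.
    apply Rdiv_lt_0_compat; [lra|apply (Hpos a y); lra]. }
assert (Z : forall u v : R, RInt (fun _ => 0) u v = 0).
{ intros u v; rewrite RInt_const; apply Rmult_0_r. }
rewrite Z in H2, H4.
unfold boundary_integral; cbv beta; lra.
Qed.

(** [C0] is quantified before F so that one constant serves all powers of a function. *)
Lemma cauchy_estimate (a b c d x0 y0 : R) : a < x0 < b -> c < y0 < d ->
  exists C0 : R, 0 < C0 /\ forall (F : C -> C) (K : R),
  (forall x y, a <= x <= b -> c <= y <= d -> C_derivable F (x, y)) ->
  (forall z, rectangle_boundary a b c d z -> Cmod (F z) <= K) ->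
  Cmod (F (x0, y0)) <= C0 * K.
Proof.
intros Hx0 Hy0.
assert (HI := cauchy_kernel_integral_pos a b c d x0 y0 Hx0 Hy0).
set (I := boundary_integral _ _ a b c d) in HI.
(* The distance from the point to the boundary, so that the kernel is at most [/ rho] there. *)
set (rho := Rmin (Rmin (x0 - a) (b - x0)) (Rmin (y0 - c) (d - y0))).
assert (Hrho : 0 < rho) by (unfold rho; repeat apply Rmin_pos; lra).
assert (Hrho' : rho <= x0 - a /\ rho <= b - x0 /\ rho <= y0 - c /\ rho <= d - y0).
{ unfold rho; clear; repeat split; unfold Rmin; repeat destruct Rle_dec; lra. }
exists (2 * (b - a + (d - c)) / rho / I); split.
{ repeat apply Rdiv_lt_0_compat; lra. }
intros F K HF HK.
destruct (Ceq_dec (F (x0, y0)) 0) as [E|E].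
{ rewrite E, Cmod_0; apply Rmult_le_pos.
  - apply Rlt_le; repeat apply Rdiv_lt_0_compat; lra.
  - eapply Rle_trans; [apply Cmod_ge_0|apply (HK (a, c))]; left; simpl; lra. }
assert (Hs : 0 < Cmod (F (x0, y0))) by now apply Cmod_gt_0.
set (s := Cmod (F (x0, y0))) in *.
(* Rotating the values of F makes F (x0, y0) a positive real, so that the
   imaginary part of the Cauchy integral is enough. *)
set (u := (RtoC s / F (x0, y0))%C).
assert (Hu : Cmod u = 1).
{ unfold u; rewrite Cmod_div by easy; fold s.
  rewrite Cmod_R, Rabs_pos_eq by lra; field; lra. }
set (k := fun w : C => (/ (w - (x0, y0)))%C).
set (Fk := fun w : C => (u * F w * k w)%C).
(* A difference quotient of u F, hence bounded near the puncture. Its boundary integral is 0, and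
   therefore that of [Fk] equals s times that of the kernel. *)
set (G := fun w : C => ((u * F w - RtoC s) * k w)%C).
assert (Hk : forall x y, (x, y) <> (x0, y0) -> C_derivable k (x, y)).
{ intros x y Hne; now apply C_derivable_inv. }
assert (HuF : forall x y, a <= x <= b -> c <= y <= d -> C_derivable (fun w => u * F w)%C (x, y)).
{ intros x y Hx Hy.
  apply (C_derivable_mult (fun _ => u) F); [apply C_derivable_const|now apply HF]. }
assert (HFk : forall x y, a <= x <= b -> c <= y <= d -> (x, y) <> (x0, y0) -> C_derivable Fk (x, y)).
{ intros x y Hx Hy Hne.
  apply (C_derivable_mult (fun w => u * F w)%C k); [now apply HuF|now apply Hk]. }
assert (HG : forall x y, a <= x <= b -> c <= y <= d -> (x, y) <> (x0, y0) -> C_derivable G (x, y)).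
{ intros x y Hx Hy Hne.
  apply (C_derivable_mult (fun w => u * F w - RtoC s)%C k); [|now apply Hk].
  apply (C_derivable_minus (fun w => u * F w)%C (fun _ => RtoC s)); [now apply HuF|apply C_derivable_const]. }
assert (HuF0 : (u * F (x0, y0))%C = RtoC s) by (unfold u; field; easy).
destruct (HuF x0 y0) as [l Hl]; try lra.
assert (Hl' := proj1 (is_C_derive_iff _ _ _) Hl (mkposreal 1 Rlt_0_1)); clear Hl.
destruct Hl' as [delta Hd]; simpl in Hd.
assert (HG0 : boundary_integral (fun x y => snd (G (x, y))) (fun x y => fst (G (x, y))) a b c d = 0).
{ apply (goursat_rectangle_punctured _ _ a b c d x0 y0 (1 + Cmod l) (delta / 2)); try lra.
  - generalize (cond_pos delta); lra.
  - intros x y Hx Hy Hne; now apply C_derivable_closed_form, HG.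
  - intros x y Hx Hy Hne.
    assert (HC : Cmod ((x, y) - (x0, y0)) < delta).
    { eapply Rle_lt_trans; [apply Cmod_le_Rabs|]; simpl; unfold Rminus in *; lra. }
    assert (Hnz : ((x, y) - (x0, y0))%C <> 0) by now apply Cminus_eq_contra.
    assert (Hg : Cmod (G (x, y)) <= 1 + Cmod l).
    { specialize (Hd (x, y) HC); rewrite HuF0 in Hd.
      unfold G, k; set (w := ((x, y) - (x0, y0))%C) in *.
      change (Cmod ((u * F (x, y) - RtoC s) / w) <= 1 + Cmod l).
      rewrite Cmod_div by easy.
      apply Rle_div_l; [now apply Cmod_gt_0|].
      replace (u * F (x, y) - RtoC s)%C with (u * F (x, y) - RtoC s - l * w + l * w)%C by ring.
      eapply Rle_trans; [apply Cmod_triangle|].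
      rewrite Cmod_mult; lra. }
    split; (eapply Rle_trans; [|exact Hg]); (eapply Rle_trans; [|apply Rmax_Cmod]);
      [apply Rmax_r|apply Rmax_l]. }
assert (Hcont : forall x y, a <= x <= b -> c <= y <= d -> (x, y) <> (x0, y0) ->
  continuity_2d_pt (fun x y => snd (Fk (x, y))) x y /\ continuity_2d_pt (fun x y => fst (Fk (x, y))) x y).
{ intros x y Hx Hy Hne; now apply closed_form_at_continuity, C_derivable_closed_form, HFk. }
assert (Hcontk : forall x y, (x, y) <> (x0, y0) ->
  continuity_2d_pt (fun x y => snd (k (x, y))) x y /\ continuity_2d_pt (fun x y => fst (k (x, y))) x y).
{ intros x y Hne; now apply closed_form_at_continuity, C_derivable_closed_form, Hk. }
assert (Hsplit : boundary_integral (fun x y => snd (G (x, y))) (fun x y => fst (G (x, y))) a b c d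
  = boundary_integral (fun x y => snd (Fk (x, y))) (fun x y => fst (Fk (x, y))) a b c d - s * I).
{ unfold I.
  rewrite <- (boundary_integral_combine (fun x y => snd (Fk (x, y))) (fun x y => fst (Fk (x, y)))
    (fun x y => snd (k (x, y))) (fun x y => fst (k (x, y)))); try lra.
  - unfold boundary_integral; f_equal; [f_equal; [f_equal|]|];
    apply RInt_ext; intros t _; unfold G, Fk; destruct (u * F _)%C; destruct (k _); simpl; ring.
  - intros x y Hx Hy.
    assert ((x, y) <> (x0, y0)) by (intros E'; injection E'; destruct Hy; lra).
    split; [apply Hcont; try easy; destruct Hy; lra|now apply Hcontk].
  - intros x y Hx Hy.
    assert ((x, y) <> (x0, y0)) by (intros E'; injection E'; destruct Hx; lra).
    split; [apply Hcont; try easy; destruct Hx; lra|now apply Hcontk]. }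
assert (Hbd : forall x y, a <= x <= b -> c <= y <= d -> rectangle_boundary a b c d (x, y) ->
  rho <= Rmax (Rabs (x - x0)) (Rabs (y - y0)) ->
  Rabs (snd (Fk (x, y))) <= K / rho /\ Rabs (fst (Fk (x, y))) <= K / rho).
{ intros x y Hx Hy Hb Hr.
  assert (Hw : rho <= Cmod ((x, y) - (x0, y0))).
  { eapply Rle_trans; [exact Hr|apply (Rmax_Cmod ((x, y) - (x0, y0))%C)]. }
  assert (Hn : ((x, y) - (x0, y0))%C <> 0) by (apply Cmod_gt_0; lra).
  assert (HC : Cmod (Fk (x, y)) <= K / rho).
  { unfold Fk, k; rewrite !Cmod_mult, Hu, Cmod_inv by easy.
    rewrite Rmult_1_l; unfold Rdiv; apply Rmult_le_compat.
    - apply Cmod_ge_0.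
    - apply Rlt_le, Rinv_0_lt_compat; lra.
    - now apply HK.
    - now apply Rinv_le_contravar. }
  split; (eapply Rle_trans; [|exact HC]); (eapply Rle_trans; [|apply Rmax_Cmod]);
    [apply Rmax_r|apply Rmax_l]. }
assert (Hbound : Rabs (boundary_integral (fun x y => snd (Fk (x, y))) (fun x y => fst (Fk (x, y))) a b c d)
  <= 2 * (b - a + (d - c)) * (K / rho)).
{ assert (Habs : forall t t0, rho <= t - t0 \/ rho <= t0 - t -> rho <= Rabs (t - t0)).
  { intros t t0 Ht; unfold Rabs; destruct Rcase_abs; lra. }
  apply boundary_integral_bound; try lra.
  - intros x Hx.
    assert ((x, c) <> (x0, y0)) by (intros E'; injection E'; lra).
    assert ((x, d) <> (x0, y0)) by (intros E'; injection E'; lra).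
    split; [apply Hcont; lra || easy|split; [apply Hcont; lra || easy|]].
    split; apply Hbd; try lra; try (left; simpl; lra);
      (eapply Rle_trans; [|apply Rmax_r]); apply Habs; lra.
  - intros y Hy.
    assert ((a, y) <> (x0, y0)) by (intros E'; injection E'; lra).
    assert ((b, y) <> (x0, y0)) by (intros E'; injection E'; lra).
    split; [apply Hcont; lra || easy|split; [apply Hcont; lra || easy|]].
    split; apply Hbd; try lra; try (right; simpl; lra);
      (eapply Rle_trans; [|apply Rmax_l]); apply Habs; lra. }
assert (HsI : s * I <= 2 * (b - a + (d - c)) * (K / rho)).
{ replace (s * I) with (boundary_integral (fun x y => snd (Fk (x, y))) (fun x y => fst (Fk (x, y))) a b c d) by lra.
  eapply Rle_trans; [apply Rle_abs|exact Hbound]. }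
replace (2 * (b - a + (d - c)) / rho / I * K) with (2 * (b - a + (d - c)) * (K / rho) / I) by (field; lra).
now apply Rle_div_r.
Qed.

Lemma pow_dominated (s K C0 : R) : 0 <= K -> 0 <= s ->
  (forall n : nat, s ^ n <= C0 * K ^ n) -> s <= K.
Proof.
intros HK Hs H.
destruct (Rle_lt_dec s K) as [|Hlt]; [easy|exfalso].
destruct (Req_dec K 0) as [E|E].
{ specialize (H 1%nat); rewrite E in H, Hlt; simpl in H; lra. }
assert (HK' : 0 < K) by lra.
assert (Hq : Rabs (s / K) > 1).
{ rewrite Rabs_pos_eq by (apply Rdiv_le_0_compat; lra).
  apply Rlt_gt, Rlt_div_r; lra. }
destruct (Pow_x_infinity (s / K) Hq (C0 + 1)) as [N HN].
specialize (HN N (le_n N)).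
rewrite Rabs_pos_eq in HN by (apply pow_le, Rdiv_le_0_compat; lra).
specialize (H N).
assert (Hp : 0 < K ^ N) by now apply pow_lt.
assert (Hd : (s / K) ^ N <= C0).
{ unfold Rdiv; rewrite Rpow_mult_distr, pow_inv; apply Rle_div_l; lra. }
lra.
Qed.

Lemma Cmod_pow (z : C) (n : nat) : Cmod (Cpow z n) = Cmod z ^ n.
Proof.
induction n as [|n IH]; simpl.
- apply Cmod_1.
- now rewrite Cmod_mult, IH.
Qed.

(* Landau's trick: the estimate for the powers of F removes the constant. *)
Theorem maximum_principle_rectangle (F : C -> C) (a b c d x0 y0 K : R) :
  a < x0 < b -> c < y0 < d ->
  (forall x y, a <= x <= b -> c <= y <= d -> C_derivable F (x, y)) ->
  (forall z, rectangle_boundary a b c d z -> Cmod (F z) <= K) ->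
  Cmod (F (x0, y0)) <= K.
Proof.
intros Hx0 Hy0 HF HK.
destruct (cauchy_estimate a b c d x0 y0 Hx0 Hy0) as (C0 & HC0 & HC).
apply (pow_dominated _ _ C0).
- eapply Rle_trans; [apply Cmod_ge_0|apply (HK (a, c))]; left; simpl; lra.
- apply Cmod_ge_0.
- intros n; rewrite <- Cmod_pow.
  apply (HC (fun w => Cpow (F w) n)).
  + intros x y Hx Hy; now apply C_derivable_pow, HF.
  + intros z Hz; rewrite Cmod_pow; apply pow_incr; split; [apply Cmod_ge_0|now apply HK].
Qed.

(** * The estimate in the strip *)

Lemma derivable_pt_lim_0_bound (g : R -> R) (l e : R) : derivable_pt_lim g 0 l -> 0 < e ->
  exists delta, 0 < delta /\ forall h, Rabs h < delta -> Rabs (g h - g 0 - l * h) <= e * Rabs h.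
Proof.
intros Hg He; destruct (Hg e He) as [delta Hd].
exists delta; split; [apply cond_pos|]; intros h Hh.
destruct (Req_dec h 0) as [->|Hn].
- replace (g 0 - g 0 - l * 0) with 0 by ring; rewrite Rabs_R0; lra.
- specialize (Hd h Hn Hh); rewrite Rplus_0_l in Hd.
  replace (g h - g 0 - l * h) with (((g h - g 0) / h - l) * h) by (field; easy).
  rewrite Rabs_mult; apply Rmult_le_compat_r; [apply Rabs_pos|lra].
Qed.

(** * The projection as the complex exponential, and holomorphy in the logarithmic coordinate *)

Lemma proj_plus (z w : C) : proj (z + w)%C = (proj z * proj w)%C.
Proof.
destruct z as [x y], w as [u v]; unfold proj, modulus, arg; simpl.
rewrite exp_plus, cos_plus, sin_plus.
unfold Cmult; simpl; f_equal; ring.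
Qed.

Lemma Cmod_proj (z : C) : Cmod (proj z) = exp (fst z).
Proof.
unfold proj, modulus, arg, Cmod; simpl fst; simpl snd.
replace ((exp (fst z) * cos (snd z)) ^ 2 + (exp (fst z) * sin (snd z)) ^ 2)
  with (exp (fst z) ^ 2 * (Rsqr (sin (snd z)) + Rsqr (cos (snd z)))) by (unfold Rsqr; ring).
rewrite sin2_cos2, Rmult_1_r; apply sqrt_pow2, Rlt_le, exp_pos.
Qed.

Lemma proj_0 : proj (RtoC 0) = RtoC 1.
Proof.
unfold proj, modulus, arg; simpl; rewrite exp_0, cos_0, sin_0.
unfold RtoC; f_equal; ring.
Qed.

Lemma is_C_derive_proj_0 : is_C_derive proj (RtoC 0) (RtoC 1).
Proof.
apply is_C_derive_iff; intros eps.
set (e := Rmin 1 (eps / 6)).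
assert (He : 0 < e) by (apply Rmin_pos; generalize (cond_pos eps); lra).
assert (He1 : e <= 1) by apply Rmin_l.
assert (He2 : e <= eps / 6) by apply Rmin_r.
clearbody e.
destruct (derivable_pt_lim_0_bound exp 1 e derivable_pt_lim_exp_0 He) as (d1 & Hd1 & H1).
destruct (derivable_pt_lim_0_bound sin 1 e derivable_pt_lim_sin_0 He) as (d2 & Hd2 & H2).
destruct (derivable_pt_lim_0_bound cos 0 e derivable_pt_lim_cos_0 He) as (d3 & Hd3 & H3).
rewrite exp_0 in H1; rewrite sin_0 in H2; rewrite cos_0 in H3.
(* The term [e / (1 + e)] yields |exp x - 1| <= (1 + e) |x| <= e. The real and imaginary errors are
   then at most 3 e |w| each, which is why e is at most eps / 6. *)
set (d := Rmin (Rmin d1 d2) (Rmin d3 (Rmin 1 (e / (1 + e))))).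
assert (Hd : 0 < d).
{ unfold d; repeat apply Rmin_pos; try easy; try lra; apply Rdiv_lt_0_compat; lra. }
assert (Hle : d <= d1 /\ d <= d2 /\ d <= d3 /\ d <= 1 /\ d <= e / (1 + e)).
{ unfold d; clear; set (q := e / _); repeat split; unfold Rmin; repeat destruct Rle_dec; lra. }
exists (mkposreal d Hd); simpl; intros w Hw.
rewrite proj_0.
replace (w - RtoC 0)%C with w in * by ring.
replace (proj w - RtoC 1 - RtoC 1 * w)%C with (proj w - RtoC 1 - w)%C by ring.
destruct w as [x y].
assert (Hx := Rle_trans _ _ _ (Rmax_l (Rabs x) (Rabs y)) (Rmax_Cmod (x, y))).
assert (Hy := Rle_trans _ _ _ (Rmax_r (Rabs x) (Rabs y)) (Rmax_Cmod (x, y))).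
set (m := Cmod (x, y)) in *.
specialize (H1 x); specialize (H2 y); specialize (H3 y).
assert (E1 := H1 ltac:(lra)); assert (E2 := H2 ltac:(lra)); assert (E3 := H3 ltac:(lra)).
eapply Rle_trans; [apply Cmod_le_Rabs|].
unfold proj, modulus, arg; simpl fst; simpl snd.
assert (Hre : Rabs (exp x * cos y + - (1) + - x) <= 3 * e * m).
{ replace (exp x * cos y + - (1) + - x)
    with ((exp x - 1 - 1 * x) * cos y + (1 + x) * (cos y - 1 - 0 * y)) by ring.
  eapply Rle_trans; [apply Rabs_triang|]; rewrite !Rabs_mult.
  replace (3 * e * m) with (e * m * 1 + 2 * (e * m)) by ring.
  apply Rplus_le_compat; apply Rmult_le_compat; try apply Rabs_pos.
  - eapply Rle_trans; [exact E1|apply Rmult_le_compat_l; lra].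
  - apply Rabs_le; generalize (COS_bound y); lra.
  - eapply Rle_trans; [apply Rabs_triang|]; rewrite Rabs_R1; lra.
  - eapply Rle_trans; [exact E3|apply Rmult_le_compat_l; lra]. }
assert (Him : Rabs (exp x * sin y + - 0 + - y) <= 3 * e * m).
{ replace (exp x * sin y + - 0 + - y)
    with ((exp x - 1) * sin y + (sin y - 0 - 1 * y)) by ring.
  eapply Rle_trans; [apply Rabs_triang|]; rewrite !Rabs_mult.
  assert (Hex : Rabs (exp x - 1) <= e).
  { replace (exp x - 1) with (exp x - 1 - 1 * x + x) by ring.
    eapply Rle_trans; [apply Rabs_triang|].
    assert ((1 + e) * Rabs x <= (1 + e) * (e / (1 + e))) by (apply Rmult_le_compat_l; lra).
    replace ((1 + e) * (e / (1 + e))) with e in * by (field; lra); lra. }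
  assert (Hsy : Rabs (sin y) <= (1 + e) * m).
  { replace (sin y) with (sin y - 0 - 1 * y + y) by ring.
    eapply Rle_trans; [apply Rabs_triang|].
    assert (e * Rabs y <= e * m) by (apply Rmult_le_compat_l; lra); lra. }
  assert (Rabs (exp x - 1) * Rabs (sin y) <= e * (2 * m)).
  { apply Rmult_le_compat; try apply Rabs_pos; try easy.
    eapply Rle_trans; [exact Hsy|apply Rmult_le_compat_r; [apply Cmod_ge_0|lra]]. }
  assert (e * Rabs y <= e * m) by (apply Rmult_le_compat_l; lra); lra. }
assert (Hem : 6 * e * m <= eps * m) by (apply Rmult_le_compat_r; [apply Cmod_ge_0|lra]).
simpl; rewrite ?Rplus_0_l in *; lra.
Qed.

(** By the functional equation [proj_plus], the expansion at 0 is multiplied by [proj z]. *)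
Lemma is_C_derive_proj (z : C) : is_C_derive proj z (proj z).
Proof.
apply is_C_derive_iff; intros eps.
assert (Hp : 0 < Cmod (proj z)) by (rewrite Cmod_proj; apply exp_pos).
assert (He : 0 < eps / Cmod (proj z)) by (apply Rdiv_lt_0_compat; [apply cond_pos|easy]).
destruct (proj1 (is_C_derive_iff _ _ _) is_C_derive_proj_0 (mkposreal _ He)) as [delta Hd].
exists delta; intros w Hw.
specialize (Hd (w - z)%C); simpl in Hd.
replace (w - z - RtoC 0)%C with (w - z)%C in Hd by ring.
specialize (Hd Hw); rewrite proj_0 in Hd.
replace (proj w) with (proj z * proj (w - z))%C by (rewrite <- proj_plus; f_equal; ring).
replace (proj z * proj (w - z) - proj z - proj z * (w - z))%C
  with (proj z * (proj (w - z) - RtoC 1 - RtoC 1 * (w - z)))%C by ring.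
rewrite Cmod_mult.
replace (eps * Cmod (w - z)) with (Cmod (proj z) * (eps / Cmod (proj z) * Cmod (w - z)))
  by (field; lra).
apply Rmult_le_compat_l; lra.
Qed.

(** The chain rule: [holomorphic_at] differentiates with respect to [proj], whose own derivative is
    [proj z], so that the derivative in the logarithmic coordinate is [l * proj z]. *)
Lemma holomorphic_at_C_derivable (f : logsurf -> C) (z : logsurf) :
  holomorphic_at f z -> C_derivable f z.
Proof.
intros [l Hl].
exists (l * proj z)%C; apply is_C_derive_iff; intros eps.
set (E := Cmod (proj z)).
assert (HE : 0 < E) by (unfold E; rewrite Cmod_proj; apply exp_pos).
assert (HL : 0 <= Cmod l) by apply Cmod_ge_0.
assert (Heps := cond_pos eps).
(* The bound E / 2 keeps |proj w - proj z| between (E / 2) |w - z| and 2 E |w - z|. The other bound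
   and [e2] give each of the two error terms at most (eps / 2) |w - z|. *)
set (e1 := Rmin (E / 2) (eps / (2 * (Cmod l + 1)))).
assert (He1 : 0 < e1) by (apply Rmin_pos; [lra|apply Rdiv_lt_0_compat; lra]).
set (e2 := eps / (4 * E)).
assert (He2 : 0 < e2) by (apply Rdiv_lt_0_compat; lra).
destruct (proj1 (is_C_derive_iff _ _ _) (is_C_derive_proj z) (mkposreal _ He1)) as [d1 Hd1].
destruct (Hl (fun u => Cmod (u - l) < e2)) as [d2 Hd2].
{ assert (He3 : 0 < e2 / 2) by lra.
  exists (mkposreal _ He3); intros u [Hu1 Hu2].
  eapply Rle_lt_trans; [apply Cmod_le_Rabs|].
  change (Rabs (fst u - fst l) < e2 / 2) in Hu1.
  change (Rabs (snd u - snd l) < e2 / 2) in Hu2.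
  simpl; unfold Rminus in *; lra. }
exists (mkposreal _ (Rmin_pos _ _ (cond_pos d1) (cond_pos d2))); simpl; intros w Hw.
destruct (Ceq_dec w z) as [->|Hne].
{ replace (f z - f z - l * proj z * (z - z))%C with (RtoC 0) by ring.
  rewrite Cmod_0; apply Rmult_le_pos; [lra|apply Cmod_ge_0]. }
assert (Hq : 0 < Cmod (w - z)) by now apply Cmod_gt_0, Cminus_eq_contra.
assert (Hw1 := Rlt_le_trans _ _ _ Hw (Rmin_l _ _)).
assert (Hw2 := Rlt_le_trans _ _ _ Hw (Rmin_r _ _)).
specialize (Hd1 w Hw1); simpl in Hd1.
assert (Hquot : Cmod ((f w - f z) / (proj w - proj z) - l) < e2).
{ apply (Hd2 w); [|exact Hne]; split.
  - change (Rabs (fst w - fst z) < d2).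
    apply Rle_lt_trans with (2 := Hw2).
    apply Rle_trans with (2 := Rmax_Cmod _); apply Rmax_l.
  - change (Rabs (snd w - snd z) < d2).
    apply Rle_lt_trans with (2 := Hw2).
    apply Rle_trans with (2 := Rmax_Cmod _); apply Rmax_r. }
set (D := (proj w - proj z)%C) in *; set (q := Cmod (w - z)) in *.
assert (HD : Cmod D <= 2 * E * q /\ E / 2 * q <= Cmod D).
{ assert (e1 * q <= E / 2 * q) by (apply Rmult_le_compat_r; [lra|apply Rmin_l]).
  assert (T1 := Cmod_triangle (D - proj z * (w - z)) (proj z * (w - z))).
  replace (D - proj z * (w - z) + proj z * (w - z))%C with D in T1 by ring.
  assert (T2 := Cmod_triangle D (- (D - proj z * (w - z)))).
  replace (D + - (D - proj z * (w - z)))%C with (proj z * (w - z))%C in T2 by ring.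
  rewrite Cmod_opp in T2; rewrite Cmod_mult in T1, T2; fold E q in T1, T2.
  assert (0 < E * q) by now apply Rmult_lt_0_compat.
  split; lra. }
assert (HD0 : D <> 0).
{ apply Cmod_gt_0; assert (0 < E / 2 * q) by (apply Rmult_lt_0_compat; lra); lra. }
replace (f w - f z - l * proj z * (w - z))%C
  with (((f w - f z) / D - l) * D + l * (D - proj z * (w - z)))%C by (field; exact HD0).
eapply Rle_trans; [apply Cmod_triangle|]; rewrite !Cmod_mult.
assert (B1 : Cmod ((f w - f z) / D - l) * Cmod D <= e2 * (2 * E * q)).
{ apply Rmult_le_compat; try apply Cmod_ge_0; lra. }
assert (B2 : Cmod l * Cmod (D - proj z * (w - z)) <= Cmod l * (eps / (2 * (Cmod l + 1)) * q)).
{ apply Rmult_le_compat_l; [easy|]; eapply Rle_trans; [exact Hd1|].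
  apply Rmult_le_compat_r; [lra|apply Rmin_r]. }
assert (B3 : e2 * (2 * E * q) = eps / 2 * q) by (unfold e2; field; lra).
assert (B4 : Cmod l * (eps / (2 * (Cmod l + 1)) * q) <= (Cmod l + 1) * (eps / (2 * (Cmod l + 1)) * q)).
{ apply Rmult_le_compat_r; [|lra].
  apply Rmult_le_pos; [apply Rlt_le, Rdiv_lt_0_compat|]; lra. }
replace ((Cmod l + 1) * (eps / (2 * (Cmod l + 1)) * q)) with (eps / 2 * q) in B4 by (field; lra).
lra.
Qed.

(* The barrier Im (w - b w^3) with b = 1 / (2 H^2) is at most 0 on the lower side
   and on the two vertical sides, at most 3 H / 2 on the upper side, and at least
   Im w on the vertical axis of symmetry. *)
Lemma small_upper_side_estimate (F : C -> C) (x0 c H K m y : R) :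
  c < y < c + H -> 0 <= m ->
  (forall u v, x0 - H <= u <= x0 + H -> c <= v <= c + H -> C_derivable F (u, v)) ->
  (forall z, rectangle_boundary (x0 - H) (x0 + H) c (c + H) z -> Cmod (F z) <= K) ->
  (forall u, x0 - H <= u <= x0 + H -> Cmod (F (u, c + H)) <= K * exp (- m)) ->
  Cmod (F (x0, y)) <= K * exp (- (2 * m / (3 * H) * (y - c))).
Proof.
intros Hy Hm HF HK Htop.
assert (HH : 0 < H) by lra.
set (b := / (2 * H ^ 2)).
assert (Hb : 0 < b).
{ apply Rinv_0_lt_compat, Rmult_lt_0_compat; [lra|now apply pow_lt]. }
assert (HbH : b * H ^ 2 = / 2) by (unfold b; field; lra).
(* Chosen with mu (3 H / 2) = m, so that on the upper side the weight is at most exp m and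
   compensates the factor exp (- m). *)
set (mu := 2 * m / (3 * H)).
assert (Hmu : 0 <= mu) by (apply Rdiv_le_0_compat; lra).
assert (HK0 : 0 <= K).
{ eapply Rle_trans; [apply Cmod_ge_0|apply (HK (x0, c))]; left; simpl; lra. }
set (s := fun w : C => (w - (x0, c))%C).
(* The factor - i mu moves the imaginary part of the cubic to the real part, so the modulus of
   [proj (phi w)] is the exponential of mu times the barrier. *)
set (phi := fun w : C => ((0, - mu)%R * (s w - RtoC b * Cpow (s w) 3))%C).
set (ubar := fun u v : R => (v - c) * (1 - 3 * b * (u - x0) ^ 2 + b * (v - c) ^ 2)).
assert (Hphi : forall u v, fst (phi (u, v)) = mu * ubar u v).
{ intros u v; unfold phi, s, ubar; simpl; ring. }
set (h := fun w : C => (F w * proj (phi w))%C).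
assert (Hh : forall u v, Cmod (h (u, v)) = Cmod (F (u, v)) * exp (mu * ubar u v)).
{ intros u v; unfold h; now rewrite Cmod_mult, Cmod_proj, Hphi. }
assert (Hs : forall z, C_derivable s z).
{ intros z; apply (C_derivable_minus (fun w => w) (fun _ => (x0, c)));
    [apply C_derivable_id|apply C_derivable_const]. }
assert (Hmax : Cmod (h (x0, y)) <= K).
{ apply (maximum_principle_rectangle h (x0 - H) (x0 + H) c (c + H)); try lra.
  - intros u v Hu Hv.
    apply (C_derivable_mult F (fun w => proj (phi w))); [now apply HF|].
    apply (C_derivable_comp proj phi); [eexists; apply is_C_derive_proj|].
    apply (C_derivable_mult (fun _ => (0, - mu)%R) (fun w => s w - RtoC b * Cpow (s w) 3)%C);
      [apply C_derivable_const|].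
    apply (C_derivable_minus s (fun w => RtoC b * Cpow (s w) 3)%C); [apply Hs|].
    apply (C_derivable_mult (fun _ => RtoC b) (fun w => Cpow (s w) 3));
      [apply C_derivable_const|apply C_derivable_pow, Hs].
  - intros [u v] Hz; rewrite Hh.
    assert (Hle0 : ubar u v <= 0 -> Cmod (F (u, v)) * exp (mu * ubar u v) <= K).
    { intros Hu0.
      assert (Hm0 : mu * ubar u v <= 0) by (rewrite <- (Rmult_0_r mu); now apply Rmult_le_compat_l).
      assert (He : exp (mu * ubar u v) <= 1).
      { rewrite <- exp_0; destruct Hm0 as [Hm0| ->]; [now apply Rlt_le, exp_increasing|lra]. }
      rewrite <- (Rmult_1_r K); apply Rmult_le_compat; try apply Cmod_ge_0; try easy.
      - apply Rlt_le, exp_pos.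
      - now apply HK. }
    destruct Hz as [[Hu [Hv|Hv]]|[Hu Hv]]; simpl in Hu, Hv.
    + apply Hle0; unfold ubar; rewrite Hv; lra.
    + assert (Hub : ubar u v <= 3 * H / 2).
      { unfold ubar; rewrite Hv; replace (c + H - c) with H by ring.
        assert (0 <= b * (u - x0) ^ 2) by (apply Rmult_le_pos; [lra|apply pow2_ge_0]).
        rewrite HbH; replace (3 * H / 2) with (H * (1 + / 2)) by field.
        apply Rmult_le_compat_l; lra. }
      assert (He : exp (mu * ubar u v) <= exp m).
      { assert (Hmm : mu * ubar u v <= m).
        { apply Rle_trans with (mu * (3 * H / 2)); [now apply Rmult_le_compat_l|].
          apply Req_le; unfold mu; field; lra. }
        destruct Hmm as [Hmm| ->]; [now apply Rlt_le, exp_increasing|lra]. }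
      replace K with (K * exp (- m) * exp m)
        by (rewrite Rmult_assoc, <- exp_plus, Rplus_opp_l, exp_0; ring).
      rewrite Hv in *; apply Rmult_le_compat; try apply Cmod_ge_0; try easy.
      * apply Rlt_le, exp_pos.
      * now apply Htop.
    + apply Hle0; unfold ubar.
      assert (Hx : (u - x0) ^ 2 = H ^ 2) by (destruct Hu as [-> | ->]; ring).
      assert (Hv2 : b * (v - c) ^ 2 <= / 2).
      { rewrite <- HbH; apply Rmult_le_compat_l; [lra|apply pow_incr; lra]. }
      rewrite Hx, Rmult_assoc, HbH.
      rewrite <- (Rmult_0_r (v - c)); apply Rmult_le_compat_l; lra. }
rewrite Hh in Hmax.
assert (Hub : y - c <= ubar x0 y).
{ unfold ubar; replace (x0 - x0) with 0 by ring.
  assert (0 <= b * (y - c) ^ 2) by (apply Rmult_le_pos; [lra|apply pow2_ge_0]).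
  rewrite <- (Rmult_1_r (y - c)) at 1; apply Rmult_le_compat_l; lra. }
assert (He : exp (mu * (y - c)) <= exp (mu * ubar x0 y)).
{ assert (Hmm : mu * (y - c) <= mu * ubar x0 y) by now apply Rmult_le_compat_l.
  destruct Hmm as [Hmm| ->]; [now apply Rlt_le, exp_increasing|lra]. }
rewrite exp_Ropp; apply Rle_div_r; [apply exp_pos|].
eapply Rle_trans; [|exact Hmax].
apply Rmult_le_compat_l; [apply Cmod_ge_0|exact He].
Qed.

Lemma Rabs_Cmod_minus (z w : C) : Rabs (Cmod z - Cmod w) <= Cmod (z - w).
Proof.
assert (T1 := Cmod_triangle (z - w) w); replace (z - w + w)%C with z in T1 by ring.
assert (T2 := Cmod_triangle z (- (z - w))).
replace (z + - (z - w))%C with w in T2 by ring; rewrite Cmod_opp in T2.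
apply Rabs_le; lra.
Qed.

(** Continuity of f at the upper side is one-sided. Replacing v by [Rmin v (PI * gamma / 2)] freezes
    f beyond that side and gives continuity on full neighbourhoods. *)
Lemma Cmod_continuity_upper_side (gamma x : R) (f : logsurf -> C) : 0 < gamma ->
  continuous_on (closed_sector gamma) f ->
  continuity_2d_pt (fun u v => Cmod (f (u, Rmin v (PI * gamma / 2)))) x (PI * gamma / 2).
Proof.
intros Hg Hc eps.
set (a := PI * gamma / 2).
assert (Ha : 0 < a) by (generalize (Rmult_lt_0_compat _ _ PI_RGT_0 Hg); unfold a; lra).
assert (Hxa : closed_sector gamma (x, a)) by (right; left; reflexivity).
assert (He : 0 < eps / 2) by (generalize (cond_pos eps); lra).
destruct (Hc (x, a) Hxa (fun w => Cmod (w - f (x, a)) < eps)) as [d Hd].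
{ exists (mkposreal _ He); intros u [Hu1 Hu2].
  eapply Rle_lt_trans; [apply Cmod_le_Rabs|].
  change (Rabs (fst u - fst (f (x, a))) < eps / 2) in Hu1.
  change (Rabs (snd u - snd (f (x, a))) < eps / 2) in Hu2.
  simpl; unfold Rminus in *; lra. }
exists (mkposreal _ (Rmin_pos _ _ (cond_pos d) Ha)); simpl; intros u v Hu Hv.
assert (Hu' := Rlt_le_trans _ _ _ Hu (Rmin_l _ _)).
assert (Hv' := Rlt_le_trans _ _ _ Hv (Rmin_l _ _)).
assert (Hva := Rlt_le_trans _ _ _ Hv (Rmin_r _ _)).
rewrite (Rmin_left a a) by lra.
eapply Rle_lt_trans; [apply Rabs_Cmod_minus|].
apply Hd.
- split; [exact Hu'|].
  change (Rabs (Rmin v a - a) < d).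
  apply Rabs_def2 in Hv'; apply Rabs_def1; unfold Rmin; destruct Rle_dec;
    generalize (cond_pos d); lra.
- apply Rabs_def2 in Hva.
  destruct (Rlt_le_dec v a) as [Hlt|Hle].
  + rewrite Rmin_left by lra; left.
    unfold sector, arg; simpl; fold a; apply Rabs_def1; lra.
  + rewrite Rmin_right by lra; right; left; reflexivity.
Qed.

Lemma strip_estimate (gamma K m delta x0 y : R) (f : logsurf -> C) :
  0 < gamma -> holomorphic_on (sector gamma) f -> continuous_on (closed_sector gamma) f ->
  (forall z, sector gamma z -> Cmod (f z) <= K) -> 0 < K -> 0 <= m ->
  (forall u, u <= x0 + PI * gamma -> Cmod (f (u, PI * gamma / 2)) <= K * exp (- m)) ->
  0 < delta -> - (PI * gamma / 2) + delta <= y < PI * gamma / 2 ->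
  Cmod (f (x0, y)) <= 2 * K * exp (- (delta / (3 * (PI * gamma)) * m)).
Proof.
intros Hg Hh Hc HK HK0 Hm Htop Hdelta Hy.
assert (Ha : 0 < PI * gamma) by now apply Rmult_lt_0_compat; [apply PI_RGT_0|].
set (a := PI * gamma / 2) in *.
assert (Ea : PI * gamma = 2 * a) by (unfold a; field).
rewrite Ea in *.
assert (Hem : 0 < K * exp (- m)) by (apply Rmult_lt_0_compat; [easy|apply exp_pos]).
destruct (uniform_continuity_2d_1d (fun u v => Cmod (f (u, Rmin v a))) (x0 - 2 * a) (x0 + 2 * a) a
  (fun x _ => Cmod_continuity_upper_side gamma x f Hg Hc) (mkposreal _ Hem)) as [d Hd].
(* The three bounds leave a height of at least delta / 2 below the point, keep the new top side
   within the uniform continuity of f, and keep the point under that side. *)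
set (eta := Rmin (Rmin (delta / 2) d) ((a - y) / 2)).
assert (Heta : 0 < eta) by (repeat apply Rmin_pos; generalize (cond_pos d); lra).
assert (Hle : eta <= delta / 2 /\ eta <= d /\ eta <= (a - y) / 2).
{ unfold eta; clear; repeat split; unfold Rmin; repeat destruct Rle_dec; lra. }
set (H := 2 * a - 2 * eta).
assert (Hsec : forall u v, - a + eta <= v <= a - eta -> sector gamma (u, v)).
{ intros u v Hv; unfold sector, arg; simpl; fold a; apply Rabs_def1; lra. }
assert (Hest : Cmod (f (x0, y)) <= 2 * K * exp (- (2 * m / (3 * H) * (y - (- a + eta))))).
{ apply small_upper_side_estimate; try (unfold H; lra).
  - intros u v _ Hv; apply holomorphic_at_C_derivable, Hh, Hsec; unfold H in Hv; lra.
  - intros [u v] Hz; apply Rle_trans with K; [|lra].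
    apply HK, Hsec; destruct Hz as [[_ Hv]|[_ Hv]]; simpl in Hv; unfold H in Hv; lra.
  - intros u Hu; unfold H in Hu.
    replace (- a + eta + H) with (a - eta) by (unfold H; ring).
    specialize (Hd u a u (a - eta)); simpl in Hd.
    rewrite (Rmin_left (a - eta) a), (Rmin_left a a) in Hd by lra.
    assert (Hd' : Rabs (Cmod (f (u, a - eta)) - Cmod (f (u, a))) < K * exp (- m)).
    { apply Hd; try lra; generalize (cond_pos d); intros; try lra.
      rewrite Rminus_diag, Rabs_R0; lra. }
    apply Rabs_def2 in Hd'.
    assert (Hu' := Htop u); lra. }
eapply Rle_trans; [exact Hest|].
apply Rmult_le_compat_l; [lra|].
assert (HH : 0 < H) by (unfold H; lra).
(* Uses H <= 2 a and y - (- a + eta) >= delta / 2. *)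
assert (Hexp : delta / (3 * (2 * a)) * m <= 2 * m / (3 * H) * (y - (- a + eta))).
{ apply Rle_trans with (2 * m / (3 * (2 * a)) * (delta / 2)).
  - apply Req_le; field; lra.
  - apply Rmult_le_compat; try lra.
    + apply Rdiv_le_0_compat; lra.
    + unfold Rdiv; apply Rmult_le_compat_l; [lra|].
      apply Rinv_le_contravar; unfold H; lra. }
destruct Hexp as [Hexp|<-]; [apply Rlt_le, exp_increasing|]; lra.
Qed.

(** * The associated function *)

(** The supremum lives in [Rbar]; the bound B excludes [p_infty] and the term v 0 excludes
    [m_infty], so [real] returns the true supremum. *)
Lemma Sup_seq_bounded (v : nat -> R) (B : R) : (forall p, v p <= B) ->
  (forall p, v p <= real (Sup_seq (fun p => Finite (v p)))) /\
  real (Sup_seq (fun p => Finite (v p))) <= B.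
Proof.
intros HB.
assert (H := Sup_seq_correct (fun p => Finite (v p))).
destruct (Sup_seq (fun p => Finite (v p))) as [l| |]; simpl in H |- *.
- split.
  + intros p; apply le_epsilon; intros eps Heps.
    now apply Rlt_le, (proj1 (H (mkposreal eps Heps))).
  + apply le_epsilon; intros eps Heps.
    destruct (proj2 (H (mkposreal eps Heps))) as [n Hn]; simpl in Hn.
    generalize (HB n); lra.
- destruct (H B) as [n Hn]; generalize (HB n); lra.
- exfalso; generalize (H (v 0%nat) 0%nat); apply Rlt_irrefl.
Qed.

Lemma bounded_eventually_decreasing (v : nat -> R) (N : nat) :
  (forall p, (N <= p)%nat -> v (S p) <= v p) -> exists B, forall p, v p <= B.
Proof.
intros HN.
assert (H0 : exists B, forall p, (p <= N)%nat -> v p <= B).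
{ clear; induction N as [|N [B IH]].
  - exists (v 0%nat); intros p Hp; replace p with 0%nat by lia; lra.
  - exists (Rmax B (v (S N))); intros p Hp.
    destruct (Nat.eq_dec p (S N)) as [->|Hne]; [apply Rmax_r|].
    eapply Rle_trans; [apply IH; lia|apply Rmax_l]. }
destruct H0 as [B HB]; exists B; intros p.
destruct (Nat.le_gt_cases p N) as [Hp|Hp]; [now apply HB|].
replace p with (N + (p - N))%nat by lia.
induction (p - N)%nat as [|k IH].
- rewrite Nat.add_0_r; now apply HB.
- rewrite Nat.add_succ_r; eapply Rle_trans; [apply HN; lia|exact IH].
Qed.

(** Consecutive terms t^p / M_p have ratio t / m_p, which is below 1 as soon as m_p exceeds t. *)
Lemma assoc_fun_bounded (M : nat -> R) (t : R) : (forall p, 0 < M p) ->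
  is_lim_seq (quotients M) p_infty -> 0 < t -> exists B, forall p, ln (t ^ p / M p) <= B.
Proof.
intros HM Hq Ht.
destruct (Hq (fun x => t < x)) as [N HN]; [now exists t|].
apply (bounded_eventually_decreasing _ N); intros p Hp.
specialize (HN p Hp); unfold quotients in HN.
apply ln_le.
- apply Rdiv_lt_0_compat; [now apply pow_lt|apply HM].
- assert (H1 := HM p); assert (H2 := HM (S p)); assert (H3 := pow_lt t p Ht).
  apply Rlt_div_r in HN; [|easy].
  apply Rle_div_l; [easy|].
  replace (t ^ p / M p * M (S p)) with (t ^ p * (M (S p) / M p)) by (field; lra).
  rewrite <- tech_pow_Rmult, Rmult_comm.
  apply Rmult_le_compat_l; [lra|].
  apply Rlt_le, Rlt_div_r; easy.
Qed.

Lemma assoc_fun_ge (M : nat -> R) (t : R) (p : nat) : (forall p, 0 < M p) ->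
  is_lim_seq (quotients M) p_infty -> 0 < t -> ln (t ^ p / M p) <= assoc_fun M t.
Proof.
intros HM Hq Ht; destruct (assoc_fun_bounded M t HM Hq Ht) as [B HB].
exact (proj1 (Sup_seq_bounded _ B HB) p).
Qed.

Lemma assoc_fun_le (M : nat -> R) (t B : R) :
  (forall p, ln (t ^ p / M p) <= B) -> assoc_fun M t <= B.
Proof. intros HB; exact (proj2 (Sup_seq_bounded _ B HB)). Qed.

Lemma assoc_fun_pos (M : nat -> R) (t : R) : (forall p, 0 < M p) -> M 0%nat = 1 ->
  is_lim_seq (quotients M) p_infty -> 0 < t -> 0 <= assoc_fun M t.
Proof.
intros HM H0 Hq Ht.
replace 0 with (ln (t ^ 0 / M 0%nat)).
- now apply assoc_fun_ge.
- rewrite H0; simpl; rewrite Rdiv_1_r; apply ln_1.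
Qed.

Lemma assoc_fun_incr (M : nat -> R) (s t : R) : (forall p, 0 < M p) ->
  is_lim_seq (quotients M) p_infty -> 0 < s <= t -> assoc_fun M s <= assoc_fun M t.
Proof.
intros HM Hq Hst; apply assoc_fun_le; intros p.
eapply Rle_trans; [|apply (assoc_fun_ge M t p HM Hq); lra].
assert (Hp := HM p); apply ln_le.
- apply Rdiv_lt_0_compat; [apply pow_lt|]; lra.
- apply Rmult_le_compat_r; [now apply Rlt_le, Rinv_0_lt_compat|].
  apply pow_incr; lra.
Qed.

(** The infimum over p of M_p (A s)^p is exp (- M(1 / (A s))). For v > 0 the hypothesis is turned
    into an upper bound ln (K / v) for the terms of the supremum. *)
Lemma flat_assoc_fun (M : nat -> R) (v K A s : R) : (forall p, 0 < M p) ->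
  0 < K -> 0 < A -> 0 < s -> (forall p : nat, v <= K * A ^ p * M p * s ^ p) ->
  v <= K * exp (- assoc_fun M (1 / (A * s))).
Proof.
intros HM HK HA Hs Hv.
destruct (Rle_lt_dec v 0) as [H0|H0].
{ eapply Rle_trans; [exact H0|]; apply Rmult_le_pos; [lra|apply Rlt_le, exp_pos]. }
assert (HAs : 0 < A * s) by now apply Rmult_lt_0_compat.
assert (Hle : assoc_fun M (1 / (A * s)) <= ln (K / v)).
{ apply assoc_fun_le; intros p.
  assert (Hp := HM p); assert (HAp := pow_lt _ p HA); assert (Hsp := pow_lt _ p Hs).
  apply ln_le.
  - apply Rdiv_lt_0_compat; [apply pow_lt, Rdiv_lt_0_compat|]; lra.
  - unfold Rdiv; rewrite Rmult_1_l, pow_inv, Rpow_mult_distr, <- Rinv_mult.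
    assert (Hd : 0 < A ^ p * s ^ p * M p) by (repeat apply Rmult_lt_0_compat; easy).
    apply Rle_div_r; [easy|].
    rewrite Rmult_comm; apply Rle_div_l; [easy|].
    eapply Rle_trans; [apply (Hv p)|]; apply Req_le; ring. }
assert (HKv : 0 < K / v) by now apply Rdiv_lt_0_compat.
apply Rle_trans with (K * exp (- ln (K / v))).
- rewrite exp_Ropp, exp_ln by easy; apply Req_le; field; lra.
- apply Rmult_le_compat_l; [lra|].
  destruct Hle as [Hle|<-]; [apply Rlt_le, exp_increasing|]; lra.
Qed.

(** * Growth of the associated function under a nonzero proximate order *)

Lemma nondecreasing_except (psi : R -> R) (e : nat -> R) (N : nat) (a b : R) : a <= b ->
  (forall x, a <= x <= b -> continuous psi x) ->
  (forall x, a < x < b -> (exists n, (n < N)%nat /\ x = e n) \/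
     exists d, is_derive psi x d /\ 0 <= d) ->
  psi a <= psi b.
Proof.
revert a b; induction N as [|N IH]; intros a b Hab Hc Hd.
(* The intermediate point may be an endpoint, where the sign of the derivative is unknown; the
   maximum with 0 is nonnegative there too and agrees with the derivative inside. *)
- destruct (MVT_gen psi a b (fun x => Rmax 0 (Derive psi x))) as (x & Hx & E).
  + intros x Hx; rewrite Rmin_left, Rmax_right in Hx by easy.
    destruct (Hd x Hx) as [(n & Hn & _)|(d & Hd1 & Hd2)]; [lia|].
    rewrite (is_derive_unique _ _ _ Hd1), Rmax_right; easy.
  + intros x Hx; rewrite Rmin_left, Rmax_right in Hx by easy.
    now apply continuity_pt_filterlim, Hc.
  + assert (0 <= Rmax 0 (Derive psi x) * (b - a)) by (apply Rmult_le_pos; [apply Rmax_l|lra]).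
    lra.
(* The interval is cut at the last exceptional point [e N]; on each piece only the first N
   remain. *)
- assert (Hsub : forall a' b', a <= a' -> b' <= b -> a' <= b' ->
    (e N <= a' \/ b' <= e N) -> psi a' <= psi b').
  { intros a' b' Ha' Hb' Hab' He; apply IH; [easy|intros; apply Hc; lra|].
    intros x Hx; destruct (Hd x) as [(n & Hn & En)|Hx']; [lra| |now right].
    left; exists n; split; [|easy].
    destruct (Nat.eq_dec n N) as [->|]; [lra|lia]. }
  destruct (Rle_lt_dec (e N) a); [apply Hsub; lra|].
  destruct (Rle_lt_dec b (e N)); [apply Hsub; lra|].
  apply Rle_trans with (psi (e N)); apply Hsub; lra.
Qed.

(* In the variable s = ln t, conditions (C) and (D) say that the derivative of
   s * rho (e^s) tends to l. *)
Lemma proximate_order_growth (rho : R -> R) (l : R) : proximate_order rho l -> 0 < l ->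
  exists S, forall s s', S <= s <= s' ->
    l / 2 * (s' - s) <= s' * rho (exp s') - s * rho (exp s).
Proof.
intros (c & Hc0 & Hcont & (e & He & Hpc) & _ & Hlim & HD) Hl.
(* The derivative is rho + r rho' ln r at r = e^s; an error l / 4 in each of the limits l and 0
   leaves at least l / 2. *)
assert (Hl4 : 0 < l / 4) by lra.
destruct (HD (fun x => Rabs (x - 0) < l / 4)) as [r1 Hr1]; [now exists (mkposreal _ Hl4)|].
destruct (Hlim (fun x => Rabs (x - l) < l / 4)) as [r2 Hr2]; [now exists (mkposreal _ Hl4)|].
set (R0 := Rmax (Rmax c 1) (Rmax r1 r2)).
assert (HR0 : c <= R0 /\ 1 <= R0 /\ r1 <= R0 /\ r2 <= R0).
{ unfold R0; clear; repeat split; unfold Rmax; repeat destruct Rle_dec; lra. }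
exists (ln (R0 + 1)); intros s s' Hs.
(* The exceptional points tend to infinity, so those up to exp s' have index below N. *)
destruct (He (fun x => exp s' < x)) as [N HN]; [now exists (exp s')|].
assert (Hbig : forall x, s <= x -> R0 < exp x).
{ intros x Hx; apply Rlt_le_trans with (R0 + 1); [lra|].
  rewrite <- (exp_ln (R0 + 1)) by lra.
  destruct (Rle_lt_or_eq_dec (ln (R0 + 1)) x) as [Hlt| ->]; try lra.
  now apply Rlt_le, exp_increasing. }
assert (H : s * rho (exp s) - l / 2 * s <= s' * rho (exp s') - l / 2 * s'); [|lra].
apply (nondecreasing_except (fun x => x * rho (exp x) - l / 2 * x) (fun n => ln (e n)) N); [lra| |].
- intros x Hx.
  apply (continuous_minus (V := R_NormedModule) (fun x => x * rho (exp x)) (fun x => l / 2 * x)).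
  + apply (continuous_mult (fun x => x) (fun x => rho (exp x))); [apply continuous_id|].
    apply (continuous_comp exp rho); [apply continuous_exp|].
    apply Hcont; generalize (Hbig x); lra.
  + apply (continuous_scal_r (V := R_NormedModule) (l / 2) (fun x => x)), continuous_id.
- intros x Hx.
  assert (HRx := Hbig x ltac:(lra)).
  destruct (Hpc (exp x)) as [[Hder _]|[(n & En) _]]; [lra| |].
  + right; exists (1 * rho (exp x) + x * (exp x * Derive rho (exp x)) - l / 2); split.
    * auto_derive; [easy|].
      change (Derive (fun y => rho y) (exp x)) with (Derive rho (exp x)); ring.
    * assert (B1 := Hr2 (exp x) ltac:(lra)); apply Rabs_def2 in B1.
      assert (B2 := Hr1 (exp x) ltac:(lra) Hder); apply Rabs_def2 in B2.
      rewrite ln_exp in B2; lra.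
  + left; exists n; split.
    * destruct (Nat.lt_ge_cases n N) as [|Hn]; [easy|exfalso].
      specialize (HN n Hn); rewrite <- En in HN.
      apply exp_lt_inv in HN; lra.
    * now rewrite <- En, ln_exp.
Qed.

(** Up to an error between A and B, ln M(t) is ln t * rho(t), which grows at least at rate l / 2 in
    ln t. A long enough shift of ln t therefore outweighs both this error and - ln c. *)
Lemma assoc_fun_scaling (M : nat -> R) (c : R) : (forall p, 0 < M p) -> M 0%nat = 1 ->
  is_lim_seq (quotients M) p_infty -> admits_nonzero_proximate_order M -> 0 < c < 1 ->
  exists lambda T, 0 < lambda <= 1 /\ 0 < T /\
    forall t, T <= t -> assoc_fun M (lambda * t) <= c * assoc_fun M t.
Proof.
intros HM H0 Hq (rho & l & Hrho & Hl & A & B & [t1 Ht1]) Hc.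
destruct (proximate_order_growth rho l Hrho Hl) as [S HS].
assert (HM1 := HM 1%nat).
(* Beyond M_1 the term p = 1 makes M(t) positive, so that its logarithm is meaningful. *)
set (T1 := Rmax (Rmax 1 t1) (Rmax (M 1%nat) (exp S))).
assert (HT1 : 1 <= T1 /\ t1 <= T1 /\ M 1%nat <= T1 /\ exp S <= T1).
{ unfold T1; clear; repeat split; unfold Rmax; repeat destruct Rle_dec; lra. }
assert (Hpos : forall t, T1 < t -> 0 < assoc_fun M t).
{ intros t Ht; eapply Rlt_le_trans; [|apply (assoc_fun_ge M t 1 HM Hq); lra].
  simpl; rewrite Rmult_1_r, <- ln_1; apply ln_increasing; [lra|].
  apply Rlt_div_r; lra. }
assert (HAB : forall t, T1 < t ->
  A <= ln t * rho t - ln (assoc_fun M t) <= B).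
{ intros t Ht; assert (H := Ht1 t ltac:(lra)); unfold d_fun in H.
  assert (Hln : 0 < ln t) by (rewrite <- ln_1; apply ln_increasing; lra).
  replace (ln t * rho t - ln (assoc_fun M t))
    with (ln t * (rho t - ln (assoc_fun M t) / ln t)) by (field; lra).
  exact H. }
assert (HAleB : A <= B) by (generalize (HAB (T1 + 1)); lra).
assert (Hlnc : ln c < 0) by (rewrite <- ln_1; apply ln_increasing; lra).
(* The shift with (l / 2) sigma = B - A - ln c. *)
set (sigma := 2 * (B - A - ln c) / l).
assert (Hsigma : 0 < sigma) by (apply Rdiv_lt_0_compat; lra).
exists (exp (- sigma)), ((T1 + 1) * exp sigma).
split; [split; [apply exp_pos|]|split].
- rewrite <- exp_0; apply Rlt_le, exp_increasing; lra.
- apply Rmult_lt_0_compat; [lra|apply exp_pos].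
- intros t Ht.
  assert (Hlam : T1 < exp (- sigma) * t).
  { apply (Rmult_le_compat_l (exp (- sigma))) in Ht; [|apply Rlt_le, exp_pos].
    replace (exp (- sigma) * ((T1 + 1) * exp sigma))
      with (T1 + 1) in Ht
      by (rewrite (Rmult_comm (T1 + 1)), <- Rmult_assoc, <- exp_plus, Rplus_opp_l, exp_0; ring).
    lra. }
  assert (Htt : T1 < t).
  { eapply Rlt_le_trans; [exact Hlam|].
    assert (0 <= t).
    { apply Rle_trans with (2 := Ht), Rmult_le_pos; [lra|apply Rlt_le, exp_pos]. }
    rewrite <- (Rmult_1_l t) at 2; apply Rmult_le_compat_r; [easy|].
    rewrite <- exp_0; apply Rlt_le, exp_increasing; lra. }
  assert (P1 := Hpos _ Hlam); assert (P2 := Hpos _ Htt).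
  assert (A1 := HAB _ Hlam); assert (A2 := HAB _ Htt).
  rewrite ln_mult, ln_exp in A1 by (apply exp_pos || lra).
  assert (HSt : S <= - sigma + ln t).
  { rewrite <- (ln_exp (- sigma)), <- ln_mult by (apply exp_pos || lra).
    rewrite <- (ln_exp S); apply ln_le; [apply exp_pos|lra]. }
  assert (G := HS (- sigma + ln t) (ln t) ltac:(lra)).
  rewrite exp_plus, !exp_ln in G by lra.
  replace (l / 2 * (ln t - (- sigma + ln t))) with (B - A - ln c) in G
    by (unfold sigma; field; lra).
  rewrite <- (exp_ln _ P1), <- (exp_ln _ P2), <- (exp_ln c) by lra.
  rewrite <- exp_plus.
  destruct (Rle_lt_or_eq_dec (ln (assoc_fun M (exp (- sigma) * t))) (ln c + ln (assoc_fun M t)))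
    as [Hlt| ->]; [lra|now apply Rlt_le, exp_increasing|lra].
Qed.

(** Boundedness is assumed on the open sector only; continuity carries the bound to the upper
    ray. *)
Lemma upper_side_bound (gamma K x : R) (f : logsurf -> C) : 0 < gamma ->
  continuous_on (closed_sector gamma) f ->
  (forall z, sector gamma z -> Cmod (f z) <= K) -> Cmod (f (x, PI * gamma / 2)) <= K.
Proof.
intros Hg Hc HK; set (a := PI * gamma / 2).
assert (Ha : 0 < a) by (generalize (Rmult_lt_0_compat _ _ PI_RGT_0 Hg); unfold a; lra).
apply le_epsilon; intros eps Heps.
destruct (Cmod_continuity_upper_side gamma x f Hg Hc (mkposreal _ Heps)) as [d Hd].
set (v := a - Rmin (d / 2) a).
assert (Hv : 0 < Rmin (d / 2) a /\ Rmin (d / 2) a <= d / 2 /\ Rmin (d / 2) a <= a).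
{ split; [apply Rmin_pos; [generalize (cond_pos d); lra|easy]|split; [apply Rmin_l|apply Rmin_r]]. }
specialize (Hd x v); fold a in Hd; simpl in Hd.
rewrite (Rmin_left v a), (Rmin_left a a) in Hd by (unfold v; lra).
assert (Hd' : Rabs (Cmod (f (x, v)) - Cmod (f (x, a))) < eps).
{ apply Hd.
  - rewrite Rminus_diag, Rabs_R0; apply cond_pos.
  - apply Rabs_def1; unfold v; generalize (cond_pos d); lra. }
apply Rabs_def2 in Hd'.
assert (Cmod (f (x, v)) <= K); [|lra].
apply HK; unfold sector, arg; simpl; fold a; apply Rabs_def1; unfold v; lra.
Qed.

(** * The final estimate and the choice of [k1] and [k2] *)

Theorem lemma3p2 (M : nat -> R)
  (M_pos : forall p, 0 < M p)
  (M_0 : M 0%nat = 1)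
  (M_lc : log_convex M)
  (M_quot : is_lim_seq (quotients M) p_infty)
  (M_prox : admits_nonzero_proximate_order M)
  (gamma : R) (gamma_pos : 0 < gamma)
  (gamma_lt : Rbar_lt (Finite gamma) (omega M))
  (f : logsurf -> C)
  (f_bounded : bounded_on (sector gamma) f)
  (f_holo : holomorphic_on (sector gamma) f)
  (f_cont : continuous_on (closed_sector gamma) f)
  (f_flat : flat_in_direction M (closed_sector gamma) f (PI * gamma / 2)) :
  forall delta : R, 0 < delta < PI * gamma ->
  exists k1 k2 : R, 0 < k1 /\ 0 < k2 /\
    forall z : logsurf,
      - (PI * gamma / 2) + delta <= arg z <= PI * gamma / 2 ->
      Cmod (f z) <= k1 * exp (- assoc_fun M (1 / (k2 * modulus z))).
Proof.
intros delta Hdelta.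
destruct f_bounded as [K0 HK0].
destruct f_flat as (r & K1 & A & Hr & HK1 & HA & Hflat).
set (K := Rmax K0 K1).
assert (HK : forall z, sector gamma z -> Cmod (f z) <= K).
{ intros z Hz; eapply Rle_trans; [now apply HK0|apply Rmax_l]. }
assert (HKpos : 0 < K) by (eapply Rlt_le_trans; [exact HK1|apply Rmax_r]).
assert (Htop : forall u, exp u <= r ->
  Cmod (f (u, PI * gamma / 2)) <= K * exp (- assoc_fun M (1 / (A * exp u)))).
{ intros u Hu.
  destruct (Hflat (u, PI * gamma / 2) eq_refl Hu) as [_ Hp].
  eapply Rle_trans; [apply (flat_assoc_fun M _ K1 A (exp u)); try easy; apply exp_pos|].
  apply Rmult_le_compat_r; [apply Rlt_le, exp_pos|apply Rmax_r]. }
assert (HPg : 0 < PI * gamma) by lra.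
set (c := delta / (3 * (PI * gamma))).
assert (Hc : 0 < c < 1).
{ split; [apply Rdiv_lt_0_compat; lra|apply Rlt_div_l; lra]. }
destruct (assoc_fun_scaling M c M_pos M_0 M_quot M_prox Hc) as (lambda & T & Hlambda & HT & Hscal).
(* The rectangle around x + i y reaches at most to abscissa x + PI gamma, and 1 / (q e^x) is the
   value of 1 / (A e^u) at that end, the smallest one on the rectangle. *)
set (q := A * exp (PI * gamma)).
assert (He := exp_pos (PI * gamma)).
assert (Hq : 0 < q) by now apply Rmult_lt_0_compat.
(* Below modulus s the whole rectangle has modulus at most r, where flatness holds, and t0 = 1 / (q
   e^x) is at least T, where the scaling holds. *)
set (s := Rmin (r / exp (PI * gamma)) (/ (q * T))).
assert (HqT : 0 < q * T) by now apply Rmult_lt_0_compat.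
assert (Hs : 0 < s).
{ apply Rmin_pos; [now apply Rdiv_lt_0_compat|now apply Rinv_0_lt_compat]. }
(* For moduli above s the associated function is at most [m1], so the factor exp m1 in k1 reduces
   the claim to boundedness. *)
set (m1 := assoc_fun M (1 / (q / lambda * s))).
assert (Hk2 : 0 < q / lambda) by (apply Rdiv_lt_0_compat; lra).
assert (Hm1 : 0 <= m1).
{ apply assoc_fun_pos; try easy; apply Rdiv_lt_0_compat; [lra|now apply Rmult_lt_0_compat]. }
assert (Hexp_le : forall u v, u <= v -> exp u <= exp v).
{ intros u v [Huv| ->]; [now apply Rlt_le, exp_increasing|lra]. }
exists (2 * K * exp m1), (q / lambda); split; [|split; [easy|]].
{ apply Rmult_lt_0_compat; [lra|apply exp_pos]. }
intros [x y]; unfold arg, modulus; simpl fst; simpl snd; intros Hy.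
assert (Hx := exp_pos x).
assert (H2K : 2 * K <= 2 * K * exp m1).
{ rewrite <- (Rmult_1_r (2 * K)) at 1; apply Rmult_le_compat_l; [lra|].
  rewrite <- exp_0; now apply Hexp_le. }
destruct (Rlt_le_dec s (exp x)) as [Hbig|Hsmall].
- assert (Hf : Cmod (f (x, y)) <= K).
  { destruct (Rlt_le_dec y (PI * gamma / 2)) as [Hlt|Hle].
    - apply HK; unfold sector, arg; simpl; apply Rabs_def1; lra.
    - replace y with (PI * gamma / 2) by lra; now apply upper_side_bound. }
  assert (Hm : assoc_fun M (1 / (q / lambda * exp x)) <= m1).
  { apply assoc_fun_incr; try easy; split.
    - apply Rdiv_lt_0_compat; [lra|now apply Rmult_lt_0_compat].
    - unfold Rdiv at 1 3; apply Rmult_le_compat_l; [lra|].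
      apply Rinv_le_contravar; [now apply Rmult_lt_0_compat|].
      apply Rmult_le_compat_l; lra. }
  assert (1 <= exp m1 * exp (- assoc_fun M (1 / (q / lambda * exp x)))).
  { rewrite <- exp_plus; rewrite <- exp_0 at 1; apply Hexp_le; lra. }
  eapply Rle_trans; [exact Hf|].
  rewrite Rmult_assoc, <- (Rmult_1_r K) at 1.
  apply Rmult_le_compat; lra.
- assert (Hsr := Rle_trans _ _ _ Hsmall (Rmin_l _ _)).
  assert (HsT := Rle_trans _ _ _ Hsmall (Rmin_r _ _)).
  set (t0 := 1 / (q * exp x)).
  assert (Hqx : 0 < q * exp x) by now apply Rmult_lt_0_compat.
  assert (Ht0 : T <= t0).
  { unfold t0; apply Rle_div_r; [easy|].
    apply (Rmult_le_compat_l (q * T)) in HsT; [|lra].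
    rewrite Rinv_r in HsT by lra; lra. }
  (* This identity dictates k2 = q / lambda: the scaling replaces c M(t0) by M(lambda t0). *)
  assert (Ek : 1 / (q / lambda * exp x) = lambda * t0) by (unfold t0; field; lra).
  rewrite Ek.
  assert (Hr' : exp (x + PI * gamma) <= r).
  { rewrite exp_plus; now apply Rle_div_r. }
  assert (Hm : forall u, u <= x + PI * gamma -> t0 <= 1 / (A * exp u)).
  { intros u Hu; unfold t0, q, Rdiv; apply Rmult_le_compat_l; [lra|].
    apply Rinv_le_contravar; [apply Rmult_lt_0_compat; [easy|apply exp_pos]|].
    rewrite Rmult_assoc, <- exp_plus, (Rplus_comm _ x).
    apply Rmult_le_compat_l; [lra|now apply Hexp_le]. }
  assert (Htop' : forall u, u <= x + PI * gamma ->
    Cmod (f (u, PI * gamma / 2)) <= K * exp (- assoc_fun M t0)).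
  { intros u Hu; eapply Rle_trans; [apply Htop, Rle_trans with (2 := Hr'), Hexp_le, Hu|].
    apply Rmult_le_compat_l; [lra|]; apply Hexp_le, Ropp_le_contravar.
    apply assoc_fun_incr; try easy; split; [lra|now apply Hm]. }
  assert (Ha0 : 0 <= assoc_fun M t0) by (apply assoc_fun_pos; try easy; lra).
  assert (Hsc := Hscal t0 Ht0).
  apply Rle_trans with (2 * K * exp (- assoc_fun M (lambda * t0)));
    [|apply Rmult_le_compat_r; [apply Rlt_le, exp_pos|exact H2K]].
  destruct (Rlt_le_dec y (PI * gamma / 2)) as [Hlt|Hle].
  + eapply Rle_trans; [apply (strip_estimate gamma K (assoc_fun M t0) delta x y f); try easy; lra|].
    apply Rmult_le_compat_l; [lra|]; apply Hexp_le; fold c; lra.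
  (* On the ray itself [strip_estimate] does not apply; flatness gives exp (- M(t0)), which is
     stronger because c < 1. *)
  + replace y with (PI * gamma / 2) by lra.
    eapply Rle_trans; [apply Htop'; lra|].
    apply Rmult_le_compat; try lra; [apply Rlt_le, exp_pos|].
    apply Hexp_le.
    assert (c * assoc_fun M t0 <= 1 * assoc_fun M t0) by (apply Rmult_le_compat_r; lra).
    lra.
Qed.
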